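(* Let $\lambda\in\mathbb{R}$ with $0<|\lambda|<1$, let $\{e_1,e_2,e_3\}$ be a standard basis of the Lie algebra $\mathfrak{h}(\lambda)$, and let $\mathfrak{h}(\lambda)$ be equipped with a Lorentzian metric $q$. Then $q$ is geodesically complete if and only if $e_3$ is timelike and $e_2$ is not spacelike. Furthermore, if $e_3$ is timelike and <br> (a) $e_2$ is timelike, then all integral curves of the corresponding geodesic field are bounded; <br> (b) $e_2$ is lightlike, then unbounded integral curves of the corresponding geodesic field exist.
   Context: For $\lambda\in\mathbb{R}$, $\mathfrak{h}(\lambda)$ is the real 3-dimensional Lie algebra admitting a basis $\{e_1,e_2,e_3\}$ whose nontrivial bracket relations are $[e_1,e_2]=e_2$, $[e_1,e_3]=\lambda e_3$ (and $[e_2,e_3]=0$). Any basis satisfying these relations is called a standard basis of $\mathfrak{h}(\lambda)$. A Lorentzian metric on a 3-dimensional real Lie algebra $\mathfrak{g}$ is a non-degenerate symmetric bilinear form $q$ on $\mathfrak{g}$ of signature $(+,+,-)$. A nonzero vector $v$ is spacelike, timelike or lightlike if $q(v,v)>0$, $q(v,v)<0$ or $q(v,v)=0$, respectively. The geodesic field of $(\mathfrak{g},q)$ is the quadratic vector field $F$ on $\mathfrak{g}$ given by $F(v)=\mathrm{ad}^\dagger_v v$, where $\mathrm{ad}^\dagger_v$ is the $q$-transpose of $\mathrm{ad}_v$; that is, $q(F(v),w)=q(v,[v,w])$ for all $v,w\in\mathfrak{g}$. Its integral curves are the solutions of $\dot v=F(v)$, always taken with maximal domain of definition. $(\mathfrak{g},q)$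 (or simply $q$) is called (geodesically) complete if the left-invariant metric defined by $q$ on a Lie group $G$ with Lie algebra $\mathfrak{g}$ is geodesically complete; equivalently (Euler–Arnold), if the geodesic field is a complete vector field, i.e. all its maximal integral curves are defined on all of $\mathbb{R}$. An integral curve is bounded if its image is a bounded subset of the vector space $\mathfrak{g}$, and unbounded otherwise. *)

(* Defs.v *)
From HB Require Import structures.
From mathcomp Require Import all_boot all_order all_algebra.
From mathcomp Require Import all_classical all_reals all_analysis.
Set Implicit Arguments.
Unset Strict Implicit.
Unset Printing Implicit Defensive.
Import Order.TTheory GRing.Theory Num.Theory.
Import numFieldNormedType.Exports.
Local Open Scope classical_set_scope.
Local Open Scope ring_scope.

Section LieAlgebra.
Variables (R : fieldType) (V : vectType R).
Implicit Types (br : {bilinear V -> V -> V}) (x y z : V).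

Definition lie_bracket br : Prop :=
  (forall x, br x x = 0) /\
  (forall x y z, br x (br y z) + br y (br z x) + br z (br x y) = 0).

(* A Lie algebra admitting such a basis is the algebra h(lambda); the brackets
   not listed follow from antisymmetry. *)
Definition standard_basis (lambda : R) br (e1 e2 e3 : V) : Prop :=
  [/\ basis_of fullv [:: e1; e2; e3], br e1 e2 = e2,
      br e1 e3 = lambda *: e3 & br e2 e3 = 0].

End LieAlgebra.

Section LorentzianMetric.
Variables (R : realFieldType) (V : vectType R).
Implicit Types (q : {symmetric V}) (v : V).

(* Signature (+,+,-), read off on an orthogonal basis. *)
Definition lorentzian q : Prop :=
  nondegenerate q /\
  exists b1 b2 b3 : V,
    [/\ basis_of fullv [:: b1; b2; b3],
        [/\ q b1 b2 = 0, q b1 b3 = 0 & q b2 b3 = 0] &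
        [/\ 0 < q b1 b1, 0 < q b2 b2 & q b3 b3 < 0]].

Definition spacelike q v : Prop := v != 0 /\ 0 < q v v.
Definition timelike q v : Prop := v != 0 /\ q v v < 0.
Definition lightlike q v : Prop := v != 0 /\ q v v = 0.

End LorentzianMetric.

Section GeodesicField.
Variables (R : realType) (V : vectType R).
Implicit Types (q : {symmetric V}) (br : {bilinear V -> V -> V}).

(* The q-transpose of f, characterized by [q_transposeP] below. *)
Definition q_transpose q (f : V -> V) (u : V) : V :=
  xget 0 [set x | forall w, q x w = q u (f w)].

Definition ad_dagger q br (v : V) : V -> V := q_transpose q (br v).

Definition geodesic_field q br (v : V) : V := ad_dagger q br v v.

Lemma q_transposeP q (f : V -> V) (u w : V) :
  linear f -> nondegenerate q -> q (q_transpose q f u) w = q u (f w).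
Proof.
move=> linf ndq.
suff /(xgetPex 0) : exists x, forall w, q x w = q u (f w) by apply.
pose n := \dim {:V}; pose b := vbasis {:V}.
pose T x : 'rV[R]_n := \row_i q x b`_i.
have linT : linear T.
  by move=> a x y; apply/rowP=> i; rewrite !mxE linearPl.
pose t : {linear V -> 'rV[R]_n} :=
  HB.pack T (GRing.isLinear.Build R V 'rV[R]_n *:%R T linT).
have eq_on_b (g h : V -> R) : linear g -> linear h ->
    (forall i : 'I_n, g b`_i = h b`_i) -> g =1 h.
  move=> ling linh gh y.
  pose G : {scalar V} := HB.pack g (GRing.isLinear.Build R V R *%R g ling).
  pose H : {scalar V} := HB.pack h (GRing.isLinear.Build R V R *%R h linh).
  rewrite -[g]/(G : V -> R) -[h]/(H : V -> R) (coord_vbasis (memvf y)) !linear_sum.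
  by apply: eq_bigr => i _; rewrite !linearZ; congr (_ * _); exact: gh.
have kerT : lker (linfun t) = 0%VS.
  apply/eqP; rewrite -subv0; apply/subvP => x.
  rewrite memv_ker lfunE memv0 => /eqP /rowP Tx0.
  move/eqP: ndq => ndq; rewrite -memv0 -ndq.
  apply/mem_orthovP => y _.
  have /(_ y) : q x =1 (fun=> 0).
    apply: eq_on_b => [a y1 y2|a y1 y2|i]; first exact: linearPr.
      by rewrite scaler0 addr0.
    by have := Tx0 i; rewrite !mxE.
  by [].
have imT : limg (linfun t) = fullv.
  apply/eqP; rewrite eqEdim subvf /= limg_dim_eq ?kerT ?capv0 //.
  by rewrite [leqLHS]dimvf /dim /= mul1n.
have /memv_imgP [x _ xE] : (\row_i q u (f b`_i) : 'rV[R]_n) \in limg (linfun t).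
  by rewrite imT memvf.
exists x; apply: eq_on_b => [a y1 y2|a y1 y2|i]; first exact: linearPr.
  by rewrite linf linearPr.
by move/rowP/(_ i): xE; rewrite lfunE !mxE.
Qed.

Lemma geodesic_fieldP q br (v w : V) :
  nondegenerate q -> q (geodesic_field q br v) w = q v (br v w).
Proof. by apply: q_transposeP => a x y; rewrite linearPr. Qed.

End GeodesicField.

Section IntegralCurves.
Variables (R : realType) (V : normedModType R).
Implicit Types (F : V -> V) (I : set R) (g : R -> V).

(* The values of g outside I are irrelevant. *)
Definition integral_curve F I g : Prop :=
  [/\ open I, is_interval I, I !=set0 &
      forall t, I t -> is_derive t 1 g (F (g t))].

Definition maximal_integral_curve F I g : Prop :=
  integral_curve F I g /\
  forall J h, integral_curve F J h -> I `<=` J ->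
    (forall t, I t -> h t = g t) -> J = I.

Definition complete_field F : Prop :=
  forall I g, maximal_integral_curve F I g -> I = setT.

Definition bounded_curve I g : Prop := bounded_set (g @` I).

End IntegralCurves.

(* By Euler-Arnold, this is the geodesic completeness of the left-invariant
   metric defined by q on a Lie group with Lie algebra (R^3, br). *)
Definition geodesically_complete (R : realType)
    (q : {symmetric 'rV[R]_3})
    (br : {bilinear 'rV[R]_3 -> 'rV[R]_3 -> 'rV[R]_3}) : Prop :=
  complete_field (geodesic_field q br).

(* Main.v *)
(* Write p_i = q(v, e_i). The field reads p2' = x1 p2, p3' = lambda x1 p3, where
   x1 is the e1-coordinate of v, and q(v, v) is conserved.
   If e3 (or e2) is spacelike, its orthogonal complement contains an isotropic v
   with x1 <> 0; the field is radial at such a v, so (1 - k t)^-1 v blows up.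
   If e3 is lightlike and e2 is not spacelike, e1 can be chosen orthogonal to
   e2, e3, and on isotropic curves x1' >= (1 + lambda) / 2 * x1^2.
   If e3 is timelike and e2 is not spacelike, the conserved energy is
   p1^2 / a + A p2^2 + B p2 p3 + C p3^2 with a, A > 0 and C >= 0; as |p3| is a
   multiple of |p2|^lambda, p1, p2 and C p3^2 stay bounded, while p3 grows at
   most exponentially. When C = 0, e1 + exp(lambda t) e2 is an unbounded curve.
   Solutions of quadratic fields come from Taylor series: a bound |v| <= r on the
   initial value gives a time of existence depending only on r. *)
Require Import Defs.
From mathcomp Require Import all_boot all_order all_algebra.
From mathcomp Require Import all_classical all_reals all_analysis.
From mathcomp Require Import ring lra.
Import Order.TTheory GRing.Theory Num.Theory.
Import numFieldNormedType.Exports.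
Set Implicit Arguments.
Unset Strict Implicit.
Unset Printing Implicit Defensive.
Local Open Scope classical_set_scope.
Local Open Scope ring_scope.

(** * Differential inequalities *)

(** In the complete case the plane of [e2] and [e3] contains a timelike vector and is Lorentzian, so
    the energy is an indefinite form in the momenta, its level sets are not compact, and its
    conservation alone bounds nothing. The second first integral p3^2 / |p2|^(2 lambda) supplies the
    missing control: it turns the cross term into a constant times |p2|^(1 + lambda), and |lambda| <
    1 puts this exponent strictly between 0 and 2. Hence A p2^2 wins for large p2, and the cross
    term stays bounded for small p2. Completeness is stated through maximal curves. Refuting it
    requires a global solution through a prescribed vector, proving it requires a continuation
    criterion; both are derived from local existence and uniqueness for quadratic fields. *)

Section ScalarInequalities.
Variable R : realType.
Implicit Types (f df w dw y dy : R -> R) (I : set R).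

Lemma is_interval_mvt I f df (s t : R) : is_interval I ->
  (forall x, I x -> is_derive x 1 f (df x)) -> I s -> I t -> s <= t ->
  exists2 c, I c & f t - f s = df c * (t - s).
Proof.
move=> itvI fdf Is It st.
have Ist x : x \in `[s, t] -> I x.
  by rewrite in_itv /= => sxt; exact: itvI Is It _ sxt.
have [c /Ist cI eq_c] : exists2 c, c \in `[s, t] & f t - f s = df c * (t - s).
  apply: MVT_segment => // [x xst|].
    by apply/fdf/Ist; exact: subset_itv_oo_cc.
  by apply: derivable_within_continuous => x /Ist /fdf fx; exact: ex_derive.
by exists c.
Qed.

Lemma is_derive_expRM (k t : R) :
  is_derive t 1 (fun s => expR (k * s)) (k * expR (k * t)).
Proof.
have dk : is_derive t 1 (fun s : R => k * s) k.
  by apply: is_derive_eq; rewrite /GRing.scale /= mulr1.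
by rewrite mulrC; exact: is_derive1_comp.
Qed.

(** The bound on [dw] makes w exp(-L s) nonincreasing and w exp(L s) nondecreasing in s; the first
    gives the estimate after [t0], the second before [t0]. *)
Lemma gronwall I w dw (L t0 t : R) : is_interval I ->
  (forall s, I s -> is_derive s 1 w (dw s)) ->
  (forall s, I s -> `|dw s| <= L * w s) ->
  I t0 -> I t -> w t <= w t0 * expR (L * `|t - t0|).
Proof.
move=> itvI wdw dwL It0 It.
have dexp k s : I s -> is_derive s 1 (fun s => w s * expR (k * s))
    ((dw s + k * w s) * expR (k * s)).
  move=> /wdw ws; have es := is_derive_expRM k s.
  by apply: is_derive_eq; rewrite /GRing.scale /=; ring.
have [t0t|/ltW tt0] := leP t0 t.
  have [c cI eqc] := is_interval_mvt itvI (dexp (- L)) It0 It t0t.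
  have : w t * expR (- L * t) <= w t0 * expR (- L * t0).
    rewrite -subr_le0 eqc mulr_le0_ge0 ?subr_ge0// mulr_le0_ge0 ?expR_ge0//.
    by have := dwL _ cI; rewrite ler_norml => /andP[]; lra.
  rewrite -(ler_pM2r (expR_gt0 (L * t))) -!mulrA -!expRD.
  rewrite (_ : - L * t + L * t = 0) ?expR0 ?mulr1; last by ring.
  by rewrite (_ : _ + _ = L * (t - t0)) 1?ger0_norm ?subr_ge0//; ring.
have [c cI eqc] := is_interval_mvt itvI (dexp L) It It0 tt0.
have : w t * expR (L * t) <= w t0 * expR (L * t0).
  rewrite -subr_ge0 eqc mulr_ge0 ?subr_ge0// mulr_ge0 ?expR_ge0//.
  by have := dwL _ cI; rewrite ler_norml => /andP[]; lra.
rewrite -(ler_pM2r (expR_gt0 (- (L * t)))) -!mulrA -!expRD.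
rewrite subrr expR0 mulr1.
by rewrite (_ : _ - _ = L * (t0 - t)) 1?distrC 1?ger0_norm ?subr_ge0//; ring.
Qed.

(** Since (1/y)' <= -k, the function 1/y would be nonpositive at time T = 1 / (k y(0)), although y
    stays positive. *)
Lemma riccati_blowup y dy (k : R) : 0 < k -> 0 < y 0 ->
  (forall t : R, is_derive t 1 y (dy t)) -> (forall t, k * y t ^+ 2 <= dy t) ->
  False.
Proof.
move=> k0 y0 ydy kdy.
have itvT : is_interval [set: R] by [].
have dy0 t : 0 <= dy t by rewrite (le_trans _ (kdy t))// mulr_ge0 ?sqr_ge0 ?ltW.
have y_ge t : 0 <= t -> y 0 <= y t.
  move=> t0; have [c _ eqc] := is_interval_mvt itvT (fun s _ => ydy s) I I t0.
  by rewrite -subr_ge0 eqc mulr_ge0// subr0.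
have y_gt0 t : 0 <= t -> 0 < y t by move=> /y_ge; exact: lt_le_trans.
have itv_ge0 : is_interval [set x : R | 0 <= x].
  by move=> a b /= a0 b0 c /andP[ac _]; rewrite (le_trans a0 ac).
pose T := (k * y 0)^-1.
have T0 : 0 < T by rewrite invr_gt0 mulr_gt0.
have [c /= c0 eqc] : exists2 c, 0 <= c &
    (y T)^-1 - (y 0)^-1 = (- (y c) ^- 2 * dy c) * (T - 0).
  apply: (@is_interval_mvt _ (fun t => (y t)^-1)
    (fun t => - (y t) ^- 2 * dy t) _ _ itv_ge0) => //=; try exact: ltW.
  by move=> x x0; apply: is_deriveV; rewrite gt_eqF ?y_gt0.
have : (y T)^-1 <= 0.
  rewrite -(subrK (y 0)^-1 (y T)^-1) eqc subr0.
  have -> : (y 0)^-1 = k * T by rewrite /T; field; rewrite !gt_eqF.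
  rewrite -mulrDl mulr_le0_ge0 ?(ltW T0)// mulNr addrC subr_le0.
  by rewrite mulrC ler_pdivlMr ?exprn_gt0 ?y_gt0.
by rewrite leNgt invr_gt0 y_gt0// ltW.
Qed.

End ScalarInequalities.

Lemma derivable_segment_bounded (R : realType) (V : normedModType R)
  (g : R -> V) (a b : R) :
  (forall t, a <= t <= b -> derivable g t 1) ->
  exists2 M, 0 <= M & forall t, a <= t <= b -> `|g t| <= M.
Proof.
move=> dg.
have : compact (g @` `[a, b]).
  apply: continuous_compact; last exact: segment_compact.
  by apply: derivable_within_continuous => x; rewrite in_itv; exact: dg.
move=> /compact_bounded/pinfty_ex_gt0[M M0 gM].
exists M => [|t abt]; first exact: ltW.
by apply: (gM (g t)); exists t => //=; rewrite in_itv.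
Qed.

Section RowVectorCurves.
Variables (R : realType) (n : nat).
Implicit Types (g : R -> 'rV[R]_n) (v w : 'rV[R]_n).

Lemma is_derive_rVP g w (t : R) :
  is_derive t 1 g w <-> forall i, is_derive t 1 (fun s => g s 0 i) (w 0 i).
Proof.
split=> [[dg <-] i|dg].
  have /derivable_mxP/(_ 0 i) dgi := dg.
  by apply: DeriveDef => //; rewrite derive_mx// mxE.
have der : derivable g t 1.
  by apply/derivable_mxP => i j; rewrite ord1; exact: ex_derive.
apply: DeriveDef => //; rewrite derive_mx//; apply/rowP => i.
by rewrite mxE; exact: derive_val.
Qed.

Lemma rV_norm_leP v (M : R) : 0 <= M ->
  `|v| <= M <-> forall i, `|v 0 i| <= M.
Proof.
move=> M0.
have -> : `|v| = \big[Num.max/0]_(ij : 'I_1 * 'I_n) `|v ij.1 ij.2|.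
  by rewrite /Num.Def.normr /= mx_normrE.
split=> [vM i|vM]; last by apply: bigmax_le => // -[i j] _ /=; rewrite ord1.
apply: le_trans vM.
exact: (le_bigmax _ (fun ij : 'I_1 * 'I_n => `|v ij.1 ij.2|) (0, i)).
Qed.

End RowVectorCurves.

(** * Power series *)

Section PowerSeries.
Variable R : realType.
Implicit Types (u v f : nat -> R).

Lemma is_cvg_pseries_geometric f (M s t : R) : 0 <= M -> 0 <= s ->
  (forall m, `|f m| <= M * s ^+ m) -> s * `|t| < 1 -> cvgn (pseries f t).
Proof.
move=> M0 s0 fM st1.
apply: normed_cvg; apply: (@series_le_cvg _ _ (geometric M (s * `|t|))).
- by move=> m; exact: normr_ge0.
- by move=> m; rewrite geometric_ge0// mulr_ge0.
- move=> m; rewrite /= normrM normrX exprMn mulrA.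
  by rewrite ler_wpM2r ?exprn_ge0.
by apply: is_cvg_geometric_series; rewrite ger0_norm ?mulr_ge0.
Qed.

Lemma is_derive_pseries f (M s t : R) : 0 <= M -> 0 < s ->
  (forall m, `|f m| <= M * s ^+ m) -> s * `|t| <= 16^-1 ->
  is_derive t 1 (fun x => limn (pseries f x))
    (limn (pseries (pseries_diffs f) t)).
Proof.
move=> M0 s0 fM st.
have diffsP (g : nat -> R) (N q : R) : 0 <= N -> 0 < q ->
    (forall m, `|g m| <= N * q ^+ m) ->
    forall m, `|pseries_diffs g m| <= (N * q) * (q *+ 2) ^+ m.
  move=> N0 q0 gN m; rewrite /pseries_diffs normrM normr_nat.
  rewrite -[q *+ 2]mulr_natr exprMn.
  have -> : N * q * (q ^+ m * 2 ^+ m) = 2 ^+ m * (N * q ^+ m.+1).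
    by rewrite exprS; ring.
  by rewrite ler_pM// -natrX ler_nat ltn_expl.
have d1 := diffsP _ _ _ M0 s0 fM.
have s20 : 0 < s *+ 2 by rewrite pmulrn_lgt0.
have d2 := diffsP _ _ _ (mulr_ge0 M0 (ltW s0)) s20 d1.
(* Each differentiation doubles the geometric ratio, because m + 1 <= 2^m. The second derivative
   series has ratio 4 s, and 4 s K = 1/2 < 1; moreover s |t| <= 1/16 < 1/8 = s K, so t lies inside
   the disc of radius K. *)
pose K : R := (8 * s)^-1.
have K0 : 0 < K by rewrite invr_gt0 mulr_gt0.
have sK : s * K = 8^-1 by rewrite /K; field; rewrite gt_eqF.
apply: (@pseries_snd_diffs _ _ K).
- by apply: (is_cvg_pseries_geometric M0 (ltW s0) fM); rewrite (gtr0_norm K0); lra.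
- apply: (is_cvg_pseries_geometric _ _ d1); rewrite ?mulr_ge0 ?mulrn_wge0 ?(ltW s0)//.
  by rewrite (gtr0_norm K0); lra.
- apply: (is_cvg_pseries_geometric _ _ d2); rewrite ?mulr_ge0 ?mulrn_wge0 ?(ltW s0)//.
  by rewrite (gtr0_norm K0); lra.
rewrite (gtr0_norm K0) -(ltr_pM2l s0) sK (le_lt_trans st)//; lra.
Qed.

(* The partial sums of u and v up to N are polynomials evaluated at 1; their
   product differs from the partial Cauchy product by the coefficients of
   index in [N, 2N), which are O(N rho^N). *)
Lemma cvg_cauchy_product u v (r rho : R) : 0 <= r -> 0 <= rho -> rho <= 8^-1 ->
  (forall m, `|u m| <= r * rho ^+ m) -> (forall m, `|v m| <= r * rho ^+ m) ->
  series (fun m => \sum_(l < m.+1) u l * v (m - l)%N) @ \oo -->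
    limn (series u) * limn (series v).
Proof.
move=> r0 rho0 rho8 ur vr.
have cvg_dom (w : nat -> R) : (forall m, `|w m| <= r * rho ^+ m) -> cvgn (series w).
  move=> wr; have := @is_cvg_pseries_geometric w r rho 1 r0 rho0 wr.
  rewrite normr1 mulr1 => cvg1; have {cvg1} := cvg1 ltac:(lra).
  rewrite /pseries (_ : (fun i => w i * 1 ^+ i) = w)//.
  by apply/funext => i; rewrite expr1n mulr1.
set conv := fun m => _.
pose err N := \sum_(N <= m < N + N)
  ((\poly_(i < N) u i) * (\poly_(i < N) v i))`_m.
have coefE N m : ((\poly_(i < N) u i) * (\poly_(i < N) v i))`_m =
    \sum_(l < m.+1) (if (l < N)%N then u l else 0) *
                    (if (m - l < N)%N then v (m - l)%N else 0).
  by rewrite coefM; apply: eq_bigr => l _; rewrite !coef_poly.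
have errE N : series conv N = series u N * series v N - err N.
  have hornE (w : nat -> R) : series w N = (\poly_(i < N) w i).[1].
    rewrite horner_poly seriesEord; apply: eq_bigr => i _.
    by rewrite expr1n mulr1.
  rewrite (hornE u) (hornE v) -hornerM (@horner_coef_wide _ (N + N)); last first.
    rewrite (leq_trans (size_polyMleq _ _))// (leq_trans (leq_pred _))//.
    by rewrite leq_add// size_poly.
  under eq_bigr do rewrite expr1n mulr1.
  rewrite -(big_mkord xpredT (fun m => (_ : {poly R})`_m)).
  rewrite (@big_cat_nat _ _ _ N)//= ?leq_addr// -/(err N) addrK.
  rewrite big_mkord seriesEord; apply: eq_bigr => m _.
  rewrite coefE; apply: eq_bigr => l _.
  have lm : (l < N)%N by rewrite (leq_ltn_trans _ (ltn_ord m))// -ltnS.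
  by rewrite lm (leq_ltn_trans (leq_subr _ _)).
have err_le N : `|err N| <= geometric (r ^+ 2 *+ 2) 2^-1 N.
  have term_le m : (N <= m < N + N)%N ->
      `|((\poly_(i < N) u i) * (\poly_(i < N) v i))`_m| <=
      (N + N)%:R * (r ^+ 2 * rho ^+ N).
    move=> /andP[Nm mN]; rewrite coefE (le_trans (ler_norm_sum _ _ _))//.
    apply: (@le_trans _ _ (\sum_(l < m.+1) r ^+ 2 * rho ^+ N)); last first.
      rewrite sumr_const card_ord -[_ *+ _]mulr_natl ler_wpM2r//.
        by rewrite mulr_ge0 ?sqr_ge0 ?exprn_ge0.
      by rewrite ler_nat.
    apply: ler_sum => l _; rewrite normrM.
    have le_if (w : nat -> R) k : (forall m, `|w m| <= r * rho ^+ m) ->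
        `|if (k < N)%N then w k else 0| <= r * rho ^+ k.
      by move=> wr; case: ifP => // _; rewrite normr0 mulr_ge0 ?exprn_ge0.
    apply: le_trans (ler_pM _ _ (le_if u l ur) (le_if v (m - l)%N vr)) _ => //.
    rewrite mulrACA -exprD -expr2 subnKC; last by rewrite -ltnS.
    rewrite ler_wpM2l ?sqr_ge0// ler_wiXn2l//; lra.
  rewrite (le_trans (ler_norm_sum _ _ _))//.
  apply: (@le_trans _ _ (\sum_(N <= m < N + N)
      ((N + N)%:R * (r ^+ 2 * rho ^+ N)))).
    by rewrite big_nat [leRHS]big_nat; apply: ler_sum => m /term_le.
  rewrite big_const_nat iter_addr_0 addKn.
  have -> : ((N + N)%:R * (r ^+ 2 * rho ^+ N)) *+ N =
      r ^+ 2 *+ 2 * (N%:R * N%:R * rho ^+ N).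
    by rewrite -mulr_natl natrD; ring.
  rewrite ler_wpM2l ?mulrn_wge0 ?sqr_ge0//.
  (* One factor N counts the indices, the other the terms in a coefficient. Each is at most 2^N, so
     a ratio of at most 1/8 still leaves decay by 1/2. *)
  have -> : (2^-1 : R) ^+ N = 2 ^+ N * 2 ^+ N * 8^-1 ^+ N.
    by rewrite -!exprMn; congr (_ ^+ _); field.
  have N2 : N%:R <= (2 : R) ^+ N by rewrite -natrX ler_nat ltnW// ltn_expl.
  rewrite ler_pM ?mulr_ge0 ?exprn_ge0// ?ler_pM//.
  by rewrite lerXn2r// nnegrE//; lra.
have err0 : err @ \oo --> 0.
  apply: norm_cvg0; apply: squeeze_cvgr; last 2 first.
  - exact: cvg_cst.
  - apply: (@cvg_geometric _ (r ^+ 2 *+ 2) 2^-1).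
    by rewrite ger0_norm ?invf_lt1 ?ltr1n.
  - by apply: nearW => N; rewrite normr_ge0 err_le.
rewrite (_ : series conv = fun N => series u N * series v N - err N); last first.
  exact/funext.
rewrite -[X in _ --> X]subr0; apply: cvgB => //.
by apply: cvgM; exact: cvg_dom.
Qed.

End PowerSeries.

(** * Quadratic vector fields *)

Lemma strong_recursion (T : Type) (x0 : T) (step : nat -> (nat -> T) -> T) :
  (forall m f g, (forall l, (l < m)%N -> f l = g l) -> step m f = step m g) ->
  exists a : nat -> T, forall m, a m = step m a.
Proof.
move=> step_ext.
(* [A m] is a table whose entries below [m] are final; the required sequence is the diagonal
   [A m.+1 m]. *)
pose A := fix A m := if m is k.+1
  then fun l => if l == k then step k (A k) else A k l else fun=> x0.
have AE m l : (l < m)%N -> A m l = A l.+1 l.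
  elim: m => // m IHm; rewrite ltnS leq_eqVlt => /predU1P[->//|lm].
  by rewrite /= (ltn_eqF lm) IHm//= eqxx.
exists (fun m => A m.+1 m) => m.
by rewrite /= eqxx; apply: step_ext => l /AE.
Qed.

Section QuadraticFields.
Variables (R : realType) (n : nat) (c : 'I_n -> 'I_n -> 'I_n -> R).
Implicit Types (v : 'rV[R]_n) (g h : R -> 'rV[R]_n) (I J : set R).

Definition quadratic_field v : 'rV[R]_n :=
  \row_i \sum_j \sum_k c i j k * (v 0 j * v 0 k).

Let F := quadratic_field.

(** The summand 1 keeps [K] positive when all coefficients vanish; the time of existence divides by
    it. *)
Let K : R := 1 + \sum_i \sum_j \sum_k `|c i j k|.

Let K_gt0 : 0 < K.
Proof.
rewrite ltr_pwDl// sumr_ge0// => i _.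
by rewrite sumr_ge0// => j _; rewrite sumr_ge0.
Qed.

Let row_sum_le i : \sum_j \sum_k `|c i j k| <= K.
Proof.
rewrite /K [X in 1 + X](bigD1 i)//= addrCA lerDl addr_ge0// sumr_ge0// => l _.
by rewrite sumr_ge0// => j _; rewrite sumr_ge0.
Qed.

(** The recursion comes from comparing the coefficients of t^m in g' = F(g), with g the power series
    of coefficients [a]. *)
Let taylor_coef v : exists a : nat -> 'rV[R]_n, a 0 = v /\
  forall m i, a m.+1 0 i = m.+1%:R^-1 * \sum_j \sum_k
    c i j k * \sum_(l < m.+1) a l 0 j * a (m - l)%N 0 k.
Proof.
pose step (m : nat) (a : nat -> 'rV[R]_n) : 'rV[R]_n := if m is p.+1 then
  \row_i (p.+1%:R^-1 * \sum_j \sum_k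
    c i j k * \sum_(l < p.+1) a l 0 j * a (p - l)%N 0 k) else v.
have [|a aE] := @strong_recursion _ (0 : 'rV[R]_n) step.
  case=> [//|p] f g fg; apply/rowP => i; rewrite !mxE; congr (_ * _).
  apply: eq_bigr => j _; apply: eq_bigr => k _; congr (_ * _).
  by apply: eq_bigr => l _; rewrite !fg// ltnS leq_subr.
exists a; split=> [|m i]; first by rewrite aE.
by rewrite {1}aE mxE.
Qed.

(** By induction every term of the convolution is at most r^2 (K r)^m; there are m + 1 of them,
    which the factor 1 / (m + 1) cancels. *)
Let taylor_coef_le v (r : R) (a : nat -> 'rV[R]_n) : `|v| <= r -> a 0 = v ->
  (forall m i, a m.+1 0 i = m.+1%:R^-1 * \sum_j \sum_k
    c i j k * \sum_(l < m.+1) a l 0 j * a (m - l)%N 0 k) ->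
  forall m i, `|a m 0 i| <= r * (K * r) ^+ m.
Proof.
move=> vr a0 aS m.
have r0 : 0 <= r by apply: le_trans vr.
elim/ltn_ind: m => -[_ i|m IHm i].
  by rewrite a0 expr0 mulr1; exact: (rV_norm_leP v r0).1.
rewrite aS normrM ger0_norm ?invr_ge0//.
rewrite mulrC ler_pdivrMr ?ltr0n//.
apply: (@le_trans _ _ (\sum_j \sum_k `|c i j k| *
    (m.+1%:R * (r ^+ 2 * (K * r) ^+ m)))).
  apply: le_trans (ler_norm_sum _ _ _) _; apply: ler_sum => j _.
  apply: le_trans (ler_norm_sum _ _ _) _; apply: ler_sum => k _.
  rewrite normrM ler_wpM2l//; apply: le_trans (ler_norm_sum _ _ _) _.
  rewrite mulr_natl -[in leRHS](card_ord m.+1) -sumr_const.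
  apply: ler_sum => l _; rewrite normrM.
  have lm : (l <= m)%N by rewrite -ltnS.
  apply: le_trans (ler_pM _ _ (IHm l _ j) (IHm (m - l)%N _ k)) _ => //.
    by rewrite ltnS leq_subr.
  by rewrite mulrACA -exprD -expr2 subnKC.
under eq_bigr do rewrite -mulr_suml.
rewrite -mulr_suml.
have -> : r * (K * r) ^+ m.+1 * m.+1%:R =
    K * (m.+1%:R * (r ^+ 2 * (K * r) ^+ m)) by rewrite exprS; ring.
rewrite ler_wpM2r//.
by rewrite !mulr_ge0 ?exprn_ge0 ?mulr_ge0 ?(ltW K_gt0).
Qed.

Lemma quadratic_local_existence (r : R) : 0 < r ->
  exists2 d : R, 0 < d & forall v (t0 : R), `|v| <= r ->
    exists2 g, g t0 = v & forall t, ball t0 d t -> is_derive t 1 g (F (g t)).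
Proof.
move=> r0; have Kr0 : 0 < K * r by rewrite mulr_gt0.
(* The Taylor series has ratio K r; this radius keeps K r |t - t0| within 1/16, as
   [is_derive_pseries] requires, and so within the 1/8 of [cvg_cauchy_product]. *)
exists (16 * (K * r))^-1 => [|v t0 vr]; first by rewrite invr_gt0 mulr_gt0.
have [a [a0 aS]] := taylor_coef v.
have ar := taylor_coef_le vr a0 aS.
pose X i s := limn (pseries (fun m => a m 0 i) s).
exists (fun t => \row_i X i (t - t0)).
  apply/rowP => i; rewrite mxE subrr /X; apply/cvg_lim => //.
  (* At time 0 all partial sums equal the initial value except the empty one, which the shift
     skips. *)
  rewrite -(cvg_shiftS _ _); apply: cvg_near_cst; apply: nearW => N.
  rewrite /pseries /= seriesEnat /= big_nat_recl// expr0 mulr1 a0.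
  by rewrite big1 ?addr0// => m _; rewrite expr0n mulr0.
move=> t /=; rewrite /ball /= distrC => td.
have {}td : K * r * `|t - t0| <= 16^-1.
  rewrite -ler_pdivlMl//; apply: le_trans (ltW td) _.
  by rewrite invfM mulrC.
apply/is_derive_rVP => i.
have -> : (fun s => (\row_j X j (s - t0)) 0 i) = X i \o shift (- t0).
  by apply/funext => s; rewrite mxE.
rewrite -[X in is_derive _ _ _ X]mulr1.
apply: is_derive1_comp; last exact: is_derive_shift.
rewrite /F mxE /=; set s := t - t0 in td *.
rewrite (_ : \sum_j _ = limn (pseries (pseries_diffs (fun m => a m 0 i)) s)).
  by apply: (@is_derive_pseries _ _ r (K * r)) => //; exact: ltW.
pose w j k m := \sum_(l < m.+1)
  (a l 0 j * s ^+ l) * (a (m - l)%N 0 k * s ^+ (m - l)).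
have wcvg j k : series (w j k) @ \oo --> X j s * X k s.
  have le_s p m : `|a m 0 p * s ^+ m| <= r * (K * r * `|s|) ^+ m.
    by rewrite normrM normrX exprMn mulrA ler_wpM2r ?exprn_ge0.
  apply: (@cvg_cauchy_product _ _ _ r (K * r * `|s|)) => [|||m|m].
  - exact: ltW.
  - by rewrite mulr_ge0// ltW.
  - lra.
  - exact: le_s.
  - exact: le_s.
apply/esym/cvg_lim => //.
(* The partial sums agree term by term: the factor m + 1 in the differentiated series cancels the
   inverse in the recursion and leaves the Cauchy products. *)
rewrite (_ : pseries _ _ = fun N => \sum_j \sum_k c i j k * series (w j k) N).
  under eq_bigr do under eq_bigr do rewrite !mxE.
  apply: cvg_big => [|j _]; first exact: add_continuous.
  apply: cvg_big => [|k _]; first exact: add_continuous.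
  by apply: cvgMl_tmp; exact: wcvg.
apply/funext => N; rewrite /pseries seriesEord /=.
under [RHS]eq_bigr do under eq_bigr do rewrite seriesEord mulr_sumr.
under [RHS]eq_bigr do rewrite exchange_big.
rewrite exchange_big; apply: eq_bigr => m _.
rewrite /pseries_diffs aS mulVKf ?pnatr_eq0// mulr_suml.
apply: eq_bigr => j _; rewrite mulr_suml; apply: eq_bigr => k _.
rewrite -mulrA mulr_suml; congr (_ * _); apply: eq_bigr => l _.
by rewrite mulrACA -exprD subnKC// -ltnS.
Qed.

(** A Lipschitz estimate on a ball, phrased for the Euclidean squared distance because, unlike the
    sup norm, it is differentiable along curves. *)
Let sqdist_deriv_le v (w : 'rV[R]_n) (M : R) : `|v| <= M -> `|w| <= M ->
  `|\sum_i 2 * (v 0 i - w 0 i) * (F v 0 i - F w 0 i)|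
    <= 4 * M * K * \sum_i (v 0 i - w 0 i) ^+ 2.
Proof.
move=> vM wM; have M0 : 0 <= M by apply: le_trans vM.
set S := \sum_i _ ^+ 2.
have sq_le i : `|v 0 i - w 0 i| ^+ 2 <= S.
  rewrite real_normK ?num_real// /S (bigD1 i)//= lerDl sumr_ge0// => j _.
  exact: sqr_ge0.
have mul_le i j : `|v 0 i - w 0 i| * `|v 0 j - w 0 j| <= S.
  have := sq_le i; have := sq_le j.
  by have := sqr_ge0 (`|v 0 i - w 0 i| - `|v 0 j - w 0 j|); nra.
apply: le_trans (ler_norm_sum _ _ _) _.
apply: (@le_trans _ _ (\sum_i \sum_j \sum_k `|c i j k| * (4 * M * S))); last first.
  under eq_bigr do under eq_bigr do rewrite -mulr_suml.
  under eq_bigr do rewrite -mulr_suml.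
  rewrite -mulr_suml [leRHS]mulrAC mulrC ler_wpM2l ?lerDr//.
  by rewrite !mulr_ge0// sumr_ge0// => i _; exact: sqr_ge0.
apply: ler_sum => i _; rewrite !mxE -sumrB mulr_sumr.
apply: le_trans (ler_norm_sum _ _ _) _; apply: ler_sum => j _.
rewrite -sumrB mulr_sumr.
apply: le_trans (ler_norm_sum _ _ _) _; apply: ler_sum => k _.
rewrite -mulrBr mulrCA normrM ler_wpM2l//.
have -> : 2 * (v 0 i - w 0 i) * (v 0 j * v 0 k - w 0 j * w 0 k) =
    2 * (v 0 j * ((v 0 i - w 0 i) * (v 0 k - w 0 k)) +
         w 0 k * ((v 0 i - w 0 i) * (v 0 j - w 0 j))) by ring.
rewrite normrM normr_nat.
have -> : 4 * M * S = 2 * (M * S + M * S) by ring.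
rewrite ler_pM2l//; apply: le_trans (ler_normD _ _) _.
by apply: lerD; rewrite !normrM ler_pM ?mulr_ge0//; exact: (rV_norm_leP _ M0).1.
Qed.

(** Both curves are bounded on the compact segment between [t0] and [t], so their squared distance
    satisfies a Gronwall inequality there and starts at 0. *)
Lemma quadratic_uniqueness I J g h (t0 t : R) :
  integral_curve F I g -> integral_curve F J h ->
  I t0 -> J t0 -> g t0 = h t0 -> I t -> J t -> g t = h t.
Proof.
move=> [_ itvI _ dg] [_ itvJ _ dh] It0 Jt0 gh It Jt.
pose a := Num.min t0 t; pose b := Num.max t0 t.
have abI s : a <= s <= b -> I s /\ J s.
  rewrite /a /b; have [_|_] := leP t0 t => abs.
    by split; [exact: itvI abs|exact: itvJ abs].
  by split; [exact: itvI abs|exact: itvJ abs].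
have [Mg Mg0 gM] : exists2 M, 0 <= M & forall s, a <= s <= b -> `|g s| <= M.
  by apply: derivable_segment_bounded => s /abI[/dg ? _]; exact: ex_derive.
have [Mh Mh0 hM] : exists2 M, 0 <= M & forall s, a <= s <= b -> `|h s| <= M.
  by apply: derivable_segment_bounded => s /abI[_ /dh ?]; exact: ex_derive.
pose M := Mg + Mh.
pose w s := \sum_i (g s 0 i - h s 0 i) ^+ 2.
have dw s : a <= s <= b -> is_derive s 1 w
    (\sum_i 2 * (g s 0 i - h s 0 i) * (F (g s) 0 i - F (h s) 0 i)).
  move=> /abI[/dg/is_derive_rVP dgs /dh/is_derive_rVP dhs].
  rewrite (_ : w = \sum_i (fun s => (g s 0 i - h s 0 i) ^+ 2)); last first.
    by apply/funext => x; rewrite fct_sumE.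
  apply: is_derive_sum => i; have dgi := dgs i; have dhi := dhs i.
  have dd : is_derive s 1 (fun s => g s 0 i - h s 0 i) (F (g s) 0 i - F (h s) 0 i).
    exact: is_deriveB.
  rewrite -mulrA mulr_natl -[_ *+ 2]/(_ + _).
  have := is_deriveM dd dd; exact.
have Sab : a <= t0 <= b /\ a <= t <= b.
  by rewrite /a /b !le_max !ge_min !lexx !orbT.
have : w t <= w t0 * expR (4 * M * K * `|t - t0|).
  apply: (@gronwall _ [set s | a <= s <= b] w _ _ _ _ _ dw);
    [| |by case: Sab|by case: Sab].
    move=> x y /= /andP[ax _] /andP[_ yb] z /andP[xz zy].
    by rewrite (le_trans ax xz) (le_trans zy yb).
  move=> s abs; apply: sqdist_deriv_le.
    by rewrite (le_trans (gM _ abs))// lerDl.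
  by rewrite (le_trans (hM _ abs))// lerDr.
rewrite {2}/w gh; under eq_bigr do rewrite subrr expr0n.
rewrite big1// mul0r => wt0; apply/rowP => i; apply/eqP.
rewrite -subr_eq0 -sqrf_eq0 eq_le sqr_ge0 andbT; apply: le_trans wt0.
by rewrite /w (bigD1 i)//= lerDl sumr_ge0// => j _; exact: sqr_ge0.
Qed.

(** By uniqueness the two curves glue to one on the union of [I] and [J], an interval because both
    contain [t0]; maximality then gives that the union is [I]. *)
Lemma maximal_integral_curve_absorb I J g h (t0 : R) :
  maximal_integral_curve F I g -> integral_curve F J h ->
  I t0 -> J t0 -> g t0 = h t0 -> J `<=` I.
Proof.
move=> [cg maxg] ch It0 Jt0 gh.
have ghIJ t := @quadratic_uniqueness _ _ _ _ t0 t cg ch It0 Jt0 gh.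
have [oI itvI _ dg] := cg; have [oJ itvJ _ dh] := ch.
pose k t := if t \in I then g t else h t.
have kg t : I t -> k t = g t by move=> It; rewrite /k mem_set.
have kh t : J t -> k t = h t.
  by rewrite /k; case: ifPn => // /[!inE] It Jt; exact: ghIJ.
suff IJE : I `|` J = I by rewrite -IJE; exact: subsetUr.
apply: (maxg _ k) => //.
split; first exact: openU.
- have near_t0 A : is_interval A -> A t0 -> A `<=` I `|` J ->
      forall x z, A x -> (x <= z <= t0) || (t0 <= z <= x) -> (I `|` J) z.
    move=> itvA At0 AIJ x z Ax /orP[xz|xz]; apply: AIJ.
      exact: itvA xz.
    exact: itvA xz.
  have side x z : (I `|` J) x -> (x <= z <= t0) || (t0 <= z <= x) -> (I `|` J) z.
    by move=> [Ix|Jx]; [apply: (near_t0 I)|apply: (near_t0 J)].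
  move=> x y IJx IJy z /andP[xz zy].
  have [zt0|/ltW t0z] := leP z t0.
    by apply: (side x) => //; rewrite xz zt0.
  by apply: (side y) => //; rewrite t0z zy orbT.
- by exists t0; left.
move=> t [It|Jt].
  rewrite kg//; apply: near_eq_is_derive (dg t It).
  by have := open_nbhs_nbhs (conj oI It); apply: filterS => s /kg.
rewrite kh//; apply: near_eq_is_derive (dh t Jt).
by have := open_nbhs_nbhs (conj oJ Jt); apply: filterS => s /kh.
Qed.

Lemma integral_curve_ball h (t0 d : R) : 0 < d ->
  (forall t, ball t0 d t -> is_derive t 1 h (F (h t))) ->
  integral_curve F (ball t0 d) h.
Proof.
move=> d0 dh; split=> //; first exact: ball_open.
  move=> x y; rewrite /ball /= !ltr_norml => xd yd z.
  by rewrite ltr_norml; lra.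
by exists t0; exact: ballxx.
Qed.

(** A bound on bounded times suffices: between a point of [I] and any target time, one existence
    time [d] serves at every point of [I], so finitely many steps reach the target. *)
Lemma maximal_integral_curve_complete I g :
  maximal_integral_curve F I g ->
  (forall T : R, exists M : R, forall t, I t -> `|t| <= T -> `|g t| <= M) ->
  I = setT.
Proof.
move=> maxg bndg; apply/seteqP; split=> // t1 _.
have [[_ _ [t2 It2] _] _] := maxg.
pose T := Num.max `|t1| `|t2|; have [M gM] := bndg T.
have r0 : 0 < `|M| + 1 by rewrite ltr_wpDl.
have [d d0 exd] := quadratic_local_existence r0.
have step t : I t -> `|t| <= T -> ball t d `<=` I.
  move=> It tT.
  have gtr : `|g t| <= `|M| + 1.
    by rewrite (le_trans (gM t It tT))// ler_wpDr// ler_norm.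
  have [h ht dh] := exd _ t gtr.
  apply: (maximal_integral_curve_absorb maxg (integral_curve_ball d0 dh) It) => //.
  exact: ballxx.
(* [N] equal steps, each shorter than [d], lead from [t2] in [I] to [t1]; the points [p m] stay in
   |t| <= T by convexity. *)
pose N := (Num.truncn (`|t1 - t2| / d)).+1.
have N0 : 0 < N%:R :> R by rewrite ltr0n.
have stepd : `|t1 - t2| / N%:R < d.
  by rewrite ltr_pdivrMr// mulrC -ltr_pdivrMr// truncnS_gt.
pose p m := t2 + m%:R / N%:R * (t1 - t2).
have pT m : (m <= N)%N -> `|p m| <= T.
  move=> mN; pose x : R := m%:R / N%:R.
  have x0 : 0 <= x by rewrite divr_ge0.
  have x1 : x <= 1 by rewrite ler_pdivrMr// mul1r ler_nat.
  have -> : p m = (1 - x) * t2 + x * t1 by rewrite /p -/x; ring.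
  have t1T : `|t1| <= T by rewrite le_max lexx.
  have t2T : `|t2| <= T by rewrite le_max lexx orbT.
  apply: le_trans (ler_normD _ _) _; rewrite (normrM (1 - x)) (normrM x).
  rewrite (ger0_norm x0) ger0_norm ?subr_ge0//.
  nra.
have Ip m : (m <= N)%N -> I (p m).
  elim: m => [_|m IHm mN]; first by rewrite /p !mul0r addr0.
  apply: (step (p m)); [exact/IHm/ltnW|exact/pT/ltnW|].
  rewrite /ball /= (_ : p m - p m.+1 = - ((t1 - t2) / N%:R)); last first.
    by rewrite /p -natr1; field; rewrite gt_eqF.
  by rewrite normrN normrM normfV (gtr0_norm N0).
have <- : p N = t1 by rewrite /p divff ?gt_eqF// mul1r addrC subrK.
exact: Ip.
Qed.

(** The union of all integral curves through [v] at time 0. Uniqueness makes their values at each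
    time agree, so [xget] picks the common value. *)
Lemma maximal_integral_curve_exists v :
  exists I g, [/\ maximal_integral_curve F I g, I 0 & g 0 = v].
Proof.
pose G t y := exists J h, [/\ integral_curve F J h, J 0, h 0 = v, J t & h t = y].
pose I := [set t | exists y, G t y].
pose g t := xget (0 : 'rV[R]_n) (G t).
have gE J h : integral_curve F J h -> J 0 -> h 0 = v ->
    forall t, J t -> I t /\ g t = h t.
  move=> ch J0 h0 t Jt; have Gt : G t (h t) by exists J, h.
  split; first by exists (h t).
  apply: xget_unique => // y [J' [h' [ch' J'0 h'0 J't <-]]].
  by apply: (quadratic_uniqueness ch' ch J'0 J0 _ J't Jt); rewrite h0.
have sub J h : integral_curve F J h -> J 0 -> h 0 = v -> J `<=` I.
  by move=> ch J0 h0 t Jt; have [] := gE _ _ ch J0 h0 t Jt.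
have [J0 [h0 [ch0 J00 h00]]] : exists J h,
    [/\ integral_curve F J h, J 0 & h 0 = v].
  have r0 : 0 < `|v| + 1 by rewrite ltr_wpDl.
  have [d d0 exd] := quadratic_local_existence r0.
  have [h h0 dh] := exd v 0 (ltac:(by rewrite lerDl)).
  exists (ball 0 d), h; split=> //; last exact: ballxx.
  exact: integral_curve_ball.
have g0 : g 0 = v by have [_ ->] := gE _ _ ch0 J00 h00 0 J00.
have cg : integral_curve F I g.
  split.
  - rewrite openE => t [y [J [h [ch J'0 h'0 Jt _]]]].
    have [oJ _ _ _] := ch; apply: filterS (open_nbhs_nbhs (conj oJ Jt)).
    exact: (sub _ _ ch J'0 h'0).
  - move=> x y [_ [J1 [h1 [c1 J10 h10 J1x _]]]] [_ [J2 [h2 [c2 J20 h20 J2y _]]]] z.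
    move=> /andP[xz zy]; have [_ itv1 _ _] := c1; have [_ itv2 _ _] := c2.
    have [z0|/ltW z0] := leP z 0.
      by apply: (sub _ _ c1 J10 h10); apply: itv1 J1x J10 _ _; rewrite xz z0.
    by apply: (sub _ _ c2 J20 h20); apply: itv2 J20 J2y _ _; rewrite z0 zy.
  - by exists 0; exact: (sub _ _ ch0 J00 h00 _ J00).
  - move=> t [_ [J [h [ch J'0 h'0 Jt _]]]]; have [oJ _ _ dh] := ch.
    have [_ ->] := gE _ _ ch J'0 h'0 t Jt.
    apply: near_eq_is_derive (dh t Jt).
    apply: filterS (open_nbhs_nbhs (conj oJ Jt)) => s Js.
    by have [_ ->] := gE _ _ ch J'0 h'0 s Js.
exists I, g; split=> //; last exact: (sub _ _ ch0 J00 h00 _ J00).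
split=> // J h ch IJ hg; apply/seteqP; split=> //.
have I0 : I 0 by exact: (sub _ _ ch0 J00 h00 _ J00).
by apply: (sub _ h) => //; [exact: IJ|rewrite hg].
Qed.

Lemma complete_quadratic_field_global v : complete_field F ->
  exists2 g, g 0 = v & forall t : R, is_derive t 1 g (F (g t)).
Proof.
move=> cF; have [I [g [maxg _ g0]]] := maximal_integral_curve_exists v.
exists g => // t; have IT := cF _ _ maxg; have [[_ _ _ dg] _] := maxg.
by apply: dg; rewrite IT.
Qed.

End QuadraticFields.

(** * The momentum equations *)

Section MomentumSystem.
Variables (R : realType) (a A B C lambda : R).
Hypotheses (a_gt0 : 0 < a) (A_gt0 : 0 < A) (C_ge0 : 0 <= C).
Hypothesis lambda_lt1 : `|lambda| < 1.
Variables (I : set R) (p1 p2 p3 : R -> R).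
Hypothesis itvI : is_interval I.
Hypothesis dp1 : forall t, I t -> is_derive t 1 p1
  (- (A * p2 t ^+ 2 + (1 + lambda) / 2 * B * (p2 t * p3 t)
      + lambda * C * p3 t ^+ 2)).
Hypothesis dp2 : forall t, I t -> is_derive t 1 p2 (p1 t / a * p2 t).
Hypothesis dp3 : forall t, I t -> is_derive t 1 p3 (lambda * (p1 t / a) * p3 t).

Let is_derive_sqr (f : R -> R) (df t : R) : is_derive t 1 f df ->
  is_derive t 1 (fun s => f s * f s) (f t * df + f t * df).
Proof. by move=> dft; exact: is_deriveM. Qed.

Let constant (f : R -> R) : (forall t, I t -> is_derive t 1 f 0) ->
  forall s t, I s -> I t -> f t = f s.
Proof.
move=> df.
have le_const s t : s <= t -> I s -> I t -> f t = f s.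
  move=> st Is It; have [u _] := is_interval_mvt itvI df Is It st.
  by rewrite mul0r => /eqP; rewrite subr_eq0 => /eqP.
move=> s t Is It; have [st|/ltW ts] := leP s t; first exact: le_const.
by apply/esym; exact: le_const.
Qed.

Let energy t := p1 t * p1 t / a + A * (p2 t * p2 t) + B * (p2 t * p3 t)
  + C * (p3 t * p3 t).

Let energy_const s t : I s -> I t -> energy t = energy s.
Proof.
apply: constant => {}t It.
have d1 := is_derive_sqr (dp1 It); have d2 := is_derive_sqr (dp2 It).
have d3 := is_derive_sqr (dp3 It).
have d23 := is_deriveM (dp2 It) (dp3 It).
have d1a : is_derive t 1 (fun s => p1 s * p1 s / a) _ :=
  is_deriveM d1 (is_derive_cst (a^-1 : R) (t : R) (1 : R)).
have d := is_deriveD (is_deriveD (is_deriveD d1a (is_deriveZ A d2))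
  (is_deriveZ B d23)) (is_deriveZ C d3).
apply: is_derive_eq d _; rewrite /GRing.scale /=; field.
by rewrite gt_eqF.
Qed.

(** The equation for [p2] is linear with a coefficient bounded on segments, so Gronwall propagates a
    zero. Hence [p2] vanishes everywhere or nowhere, and in the second case ln(p2^2) makes sense
    along the whole curve. *)
Let p2_zero s t : I s -> I t -> p2 s = 0 -> p2 t = 0.
Proof.
move=> Is It p2s.
pose l := Num.min s t; pose u := Num.max s t.
have luI x : l <= x <= u -> I x.
  by rewrite /l /u; have [_|_] := leP s t => lu; exact: itvI lu.
have [M M0 p1M] : exists2 M, 0 <= M & forall x, l <= x <= u -> `|p1 x| <= M.
  by apply: derivable_segment_bounded => x /luI/dp1 d; exact: ex_derive.
have [ls lt] : l <= s <= u /\ l <= t <= u.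
  by rewrite /l /u !le_max !ge_min !lexx !orbT.
have : p2 t * p2 t <= p2 s * p2 s * expR (2 * M / a * `|t - s|).
  apply: (@gronwall _ [set x | l <= x <= u] (fun x => p2 x * p2 x) (fun x =>
    p2 x * (p1 x / a * p2 x) + p2 x * (p1 x / a * p2 x)) _ _ _ _ _ _ ls lt).
  - move=> x y /= /andP[lx _] /andP[_ yu] z /andP[xz zy].
    by rewrite (le_trans lx xz) (le_trans zy yu).
  - by move=> x /luI Ix; apply: is_derive_sqr; exact: dp2.
  move=> x lxu.
  have -> : p2 x * (p1 x / a * p2 x) + p2 x * (p1 x / a * p2 x) =
      2 / a * p1 x * (p2 x * p2 x) by ring.
  rewrite normrM [X in _ * X]ger0_norm -?expr2 ?sqr_ge0// ler_wpM2r ?sqr_ge0//.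
  rewrite normrM ger0_norm ?divr_ge0 ?(ltW a_gt0)// mulrAC.
  rewrite ler_wpM2r ?invr_ge0 ?(ltW a_gt0)//.
  by rewrite ler_pM2l//; exact: p1M.
rewrite p2s !mul0r => le0; apply/eqP.
by rewrite -sqrf_eq0 eq_le sqr_ge0 andbT expr2.
Qed.

(* When p2 does not vanish, p3 ^ 2 = k * |p2| ^ (2 lambda) along the curve, so
   the cross term B * p2 * p3 is of order |p2| ^ (1 + lambda), which A * p2 ^ 2
   dominates for large p2 because |lambda| < 1. *)
Lemma momentum_energy_bound : exists M, forall t, I t ->
  p1 t ^+ 2 / a + A * p2 t ^+ 2 + C * p3 t ^+ 2 <= M.
Proof.
have [[t0 It0]|I0] := pselect (I !=set0); last first.
  by exists 0 => t It; case: I0; exists t.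
pose E := energy t0.
have energyE t : I t -> p1 t ^+ 2 / a + A * p2 t ^+ 2 + C * p3 t ^+ 2 =
    E - B * (p2 t * p3 t).
  by move=> It; rewrite /E (energy_const It It0) /energy; ring.
have [p20|p20] := eqVneq (p2 t0) 0.
  exists E => t It; rewrite energyE// (p2_zero It0 It p20).
  by rewrite mul0r mulr0 subr0.
have p2_neq0 t : I t -> p2 t != 0.
  by move=> It; apply: contra_neq p20; exact: p2_zero.
have p2_gt0 t : I t -> 0 < p2 t * p2 t.
  by move=> It; rewrite -expr2 exprn_even_gt0// p2_neq0.
(* Working with ln(p2^2) covers both signs of [p2]; [k] is the first integral p3^2 / |p2|^(2
   lambda). *)
pose s t := ln (p2 t * p2 t).
pose k t := p3 t * p3 t * expR (- lambda * s t).
have dk t : I t -> is_derive t 1 k 0.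
  move=> It; have d2 := is_derive_sqr (dp2 It); have d3 := is_derive_sqr (dp3 It).
  have ds := @is_derive1_comp R (@ln R) (fun x => p2 x * p2 x) _ _ _
    (is_derive1_ln (p2_gt0 t It)) d2.
  have de := @is_derive1_comp R (fun x => expR (- lambda * x)) s _ _ _
    (is_derive_expRM (- lambda) (s t)) ds.
  apply: is_derive_eq (is_deriveM d3 de) _; rewrite /GRing.scale /= /s.
  by field; rewrite p2_neq0//= gt_eqF.
have kE t : I t -> p3 t ^+ 2 = k t0 * expR (lambda * s t).
  move=> It; rewrite -(constant dk It0 It) /k -mulrA -expRD mulNr addNr expR0.
  by rewrite mulr1.
have k0 : 0 <= k t0 by rewrite mulr_ge0 ?expR_ge0// -expr2 sqr_ge0.
pose y := (1 + lambda) / 2.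
have [y0 y1] : 0 < y /\ y < 1.
  by move: lambda_lt1; rewrite /y ltr_norml => /andP[]; split; lra.
have cross t : I t -> `|p2 t * p3 t| = Num.sqrt (k t0) * expR (y * s t).
  move=> It; apply/eqP; rewrite -(@eqrXn2 _ 2)// ?mulr_ge0 ?sqrtr_ge0 ?expR_ge0//.
  rewrite real_normK ?num_real// !exprMn sqr_sqrtr// kE//.
  have -> : p2 t ^+ 2 = expR (s t) by rewrite lnK// posrE; exact: p2_gt0.
  rewrite mulrCA -expRD -expRM_natl; apply/eqP; congr (_ * expR _).
  by rewrite /y; field.
(* For s >= 0, dividing the energy identity by exp(y s) >= 1 gives A exp((1 - y) s) <= N, and 1 + x
   <= exp x turns this into s <= N / (A (1 - y)). For s <= 0 the bound is trivial as [s1] is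
   nonnegative. *)
pose N := `|E| + `|B| * Num.sqrt (k t0).
have N0 : 0 <= N by rewrite addr_ge0// mulr_ge0// sqrtr_ge0.
pose s1 := N / (A * (1 - y)).
have s_le t : I t -> s t <= s1.
  move=> It; have A1 : 0 < A * (1 - y) by rewrite mulr_gt0// subr_gt0.
  have [s0|/ltW s0] := leP (s t) 0.
    by apply: le_trans s0 _; rewrite divr_ge0// ltW.
  rewrite ler_pdivlMr//.
  have e1 : 1 <= expR (y * s t) by rewrite -expR0 ler_expR mulr_ge0// ltW.
  have : A * expR ((1 - y) * s t) <= N.
    rewrite -(@ler_pM2r _ (expR (y * s t))) ?expR_gt0// -mulrA -expRD.
    have -> : (1 - y) * s t + y * s t = s t by ring.
    have -> : expR (s t) = p2 t ^+ 2 by rewrite lnK// posrE; exact: p2_gt0.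
    have := energyE _ It; have := sqr_ge0 (p1 t); have := sqr_ge0 (p3 t).
    move=> p3ge0 p1ge0.
    have h1 : 0 <= p1 t ^+ 2 / a by rewrite divr_ge0// ltW.
    have h3 : 0 <= C * p3 t ^+ 2 by rewrite mulr_ge0.
    have h4 : - (B * (p2 t * p3 t)) <= `|B| * Num.sqrt (k t0) * expR (y * s t).
      by rewrite -mulrA -cross// -normrM -normrN ler_norm.
    have h5 : E <= `|E| * expR (y * s t).
      by rewrite (le_trans (ler_norm E))// ler_peMr.
    by rewrite /N mulrDl; lra.
  apply: le_trans; rewrite mulrC -mulrA ler_pM2l//.
  by apply: le_trans (expR_ge1Dx _); rewrite lerDr.
exists (E + `|B| * (Num.sqrt (k t0) * expR (y * s1))) => t It.
rewrite energyE// lerD2l (le_trans (ler_norm _))// normrN normrM cross//.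
by rewrite ler_wpM2l// ler_wpM2l ?sqrtr_ge0// ler_expR ler_wpM2l ?(ltW y0)// s_le.
Qed.

(** This covers C = 0, where the energy bound says nothing about [p3]: bounded [p1] makes the
    equation of [p3] linear with bounded coefficient. *)
Lemma momentum_growth_bound T : exists M, forall t, I t -> `|t| <= T ->
  p3 t ^+ 2 <= M.
Proof.
have [[t0 It0]|I0] := pselect (I !=set0); last first.
  by exists 0 => t It; case: I0; exists t.
have [M energyM] := momentum_energy_bound.
(* The bound uses |x| <= 1 + x^2 in place of a square root. *)
have p1M t : I t -> `|p1 t / a| <= (1 + M * a) / a.
  move=> It; rewrite normrM normfV (gtr0_norm a_gt0).
  rewrite ler_wpM2r ?invr_ge0 ?(ltW a_gt0)//.
  have : p1 t ^+ 2 <= M * a.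
    rewrite -ler_pdivrMr//; apply: le_trans (energyM t It).
    have A2 : 0 <= A * p2 t ^+ 2 by rewrite mulr_ge0 ?sqr_ge0// ltW.
    have C3 : 0 <= C * p3 t ^+ 2 by rewrite mulr_ge0 ?sqr_ge0.
    lra.
  have := sqr_ge0 (`|p1 t| - 1); rewrite -[p1 t ^+ 2]real_normK ?num_real//.
  by have := normr_ge0 (p1 t); nra.
pose L := 2 * ((1 + M * a) / a).
exists (p3 t0 * p3 t0 * expR (L * (T + `|t0|))) => t It tT.
have L0 : 0 <= L by rewrite mulr_ge0// (le_trans _ (p1M _ It0)).
apply: (@le_trans _ _ (p3 t0 * p3 t0 * expR (L * `|t - t0|))); last first.
  rewrite ler_wpM2l -?expr2 ?sqr_ge0// ler_expR ler_wpM2l//.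
  by rewrite (le_trans (ler_normB _ _))// lerD2r.
rewrite expr2; apply: (gronwall itvI (fun x Ix => is_derive_sqr (dp3 Ix))) => //.
move=> x Ix.
have -> : p3 x * (lambda * (p1 x / a) * p3 x) +
    p3 x * (lambda * (p1 x / a) * p3 x) = 2 * (lambda * (p1 x / a)) * (p3 x * p3 x) by ring.
rewrite normrM [X in _ * X]ger0_norm -?expr2 ?sqr_ge0// ler_wpM2r ?sqr_ge0//.
rewrite normrM normr_nat ler_pM2l// normrM.
apply: le_trans (p1M x Ix); rewrite -[leRHS]mul1r ler_wpM2r// ltW//.
Qed.

End MomentumSystem.

(** * Lorentzian forms *)

Section Bases.
Variables (K : fieldType) (V : vectType K).
Implicit Types a b c v : V.

Lemma basis3P a b c : basis_of fullv [:: a; b; c] <->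
  (forall v, exists x y z, v = x *: a + y *: b + z *: c) /\
  (forall x y z, x *: a + y *: b + z *: c = 0 -> [/\ x = 0, y = 0 & z = 0]).
Proof.
have sum3 (k : 'I_3 -> K) : \sum_(i < 3) k i *: [:: a; b; c]`_i =
    k ord0 *: a + k (lift ord0 ord0) *: b + k (lift ord0 (lift ord0 ord0)) *: c.
  by rewrite !big_ord_recl big_ord0 /= addr0 addrA.
pose k3 (x y z : K) (i : 'I_3) := [:: x; y; z]`_i.
split=> [abc|[spanP freeP_]].
  split=> [v|x y z xyz].
    have /(@coord_basis _ _ _ _ [tuple a; b; c]) -> := memvf v; last by [].
    by rewrite sum3; do 3 eexists.
  have /(@freeP _ _ _ [tuple a; b; c]) f3 := basis_free abc.
  have {}f3 := f3 (k3 x y z) _; rewrite sum3 in f3; have {}f3 := f3 xyz.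
  by split; [exact: (f3 ord0)|exact: (f3 (lift ord0 ord0))|
    exact: (f3 (lift ord0 (lift ord0 ord0)))].
apply/andP; split.
  rewrite eqEsubv subvf; apply/subvP => v _.
  have [x [y [z ->]]] := spanP v.
  by rewrite !memvD ?memvZ// memv_span// !inE eqxx ?orbT.
apply/(@freeP _ _ _ [tuple a; b; c]) => k; rewrite sum3 => /freeP_[k0 k1 k2].
case; case=> [|[|[|//]]] lt3.
- by rewrite -[RHS]k0; congr k; exact: val_inj.
- by rewrite -[RHS]k1; congr k; exact: val_inj.
- by rewrite -[RHS]k2; congr k; exact: val_inj.
Qed.

End Bases.

Section SymmetricForms.
Variables (R : realFieldType) (U : lmodType R) (q : {symmetric U}).
Implicit Types u v w : U.

Lemma sformC u v : q u v = q v u.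
Proof. by rewrite hermC expr0 mul1r. Qed.
Lemma sformDl u v w : q (u + v) w = q u w + q v w.
Proof. exact: linearDl. Qed.
Lemma sformDr u v w : q w (u + v) = q w u + q w v.
Proof. exact: linearDr. Qed.
Lemma sformZl a u v : q (a *: u) v = a * q u v.
Proof. exact: linearZl_LR. Qed.
Lemma sformZr a u v : q v (a *: u) = a * q v u.
Proof. exact: linearZr_LR. Qed.

Definition sformE := (sformDl, sformDr, sformZl, sformZr).

End SymmetricForms.

Section LorentzianForms.
Variables (R : realFieldType) (V : vectType R) (q : {symmetric V}).
Implicit Types u v w e f : V.

(** In an orthogonal basis, [S] is the spacelike part of q(w, w). Orthogonality expresses the
    product of the third coordinates through the other two, and Cauchy-Schwarz with q(u, u) < 0
    gives - B3 w3^2 < S unless S = 0, which forces w = 0. *)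
Lemma timelike_orthogonal_gt0 u w : lorentzian q ->
  q u u < 0 -> q u w = 0 -> w != 0 -> 0 < q w w.
Proof.
move=> [_ [b1 [b2 [b3 [/basis3P[span_b _] [b12 b13 b23]]]]]].
move=> [b1_gt0 b2_gt0 b3_lt0].
have [u1 [u2 [u3 ->]]] := span_b u; have [w1 [w2 [w3 ->]]] := span_b w.
have bD : (q b2 b1 = 0) * (q b3 b1 = 0) * (q b3 b2 = 0).
  by rewrite !(sformC q b2 b1) !(sformC q b3) b12 b13 b23.
rewrite !sformE !(b12, b13, b23, bD).
move: b1_gt0 b2_gt0 b3_lt0.
set B1 := q b1 b1; set B2 := q b2 b2; set B3 := q b3 b3 => B1_gt0 B2_gt0 B3_lt0.
rewrite !(mulr0, addr0, add0r) => u_lt0 uw w_neq0.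
set S := B1 * w1 ^+ 2 + B2 * w2 ^+ 2.
have S_ge0 : 0 <= S by rewrite addr_ge0// mulr_ge0 ?sqr_ge0// ltW.
have U_lt : B1 * u1 ^+ 2 + B2 * u2 ^+ 2 < - B3 * u3 ^+ 2 by lra.
have u3_gt0 : 0 < - B3 * u3 ^+ 2.
  apply: le_lt_trans U_lt.
  by rewrite addr_ge0// mulr_ge0 ?sqr_ge0// ltW.
have uwE : B1 * u1 * w1 + B2 * u2 * w2 = - B3 * u3 * w3 by lra.
have cauchy : (- B3 * u3 * w3) ^+ 2 <= (B1 * u1 ^+ 2 + B2 * u2 ^+ 2) * S.
  rewrite -uwE -subr_ge0.
  have -> : (B1 * u1 ^+ 2 + B2 * u2 ^+ 2) * S - (B1 * u1 * w1 + B2 * u2 * w2) ^+ 2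
      = B1 * B2 * (u1 * w2 - u2 * w1) ^+ 2 by rewrite /S; ring.
  by rewrite mulr_ge0 ?sqr_ge0// mulr_ge0// ltW.
have [S0|S_neq0] := eqVneq S 0; last first.
  have S_gt0 : 0 < S by rewrite lt_neqAle eq_sym S_neq0.
  have : (- B3 * u3 ^+ 2) * (- B3 * w3 ^+ 2) < (- B3 * u3 ^+ 2) * S.
    apply: (@le_lt_trans _ _ ((B1 * u1 ^+ 2 + B2 * u2 ^+ 2) * S)).
      by apply: le_trans cauchy; rewrite le_eqVlt; apply/orP; left; apply/eqP; ring.
    by rewrite ltr_pM2r.
  by rewrite ltr_pM2l// /S; lra.
exfalso; move/eqP: w_neq0; apply.
have w1_0 : w1 = 0.
  apply/eqP; rewrite -sqrf_eq0; move: S0; rewrite /S; have := sqr_ge0 w2.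
  have := sqr_ge0 w1 => w1ge w2ge S0; apply/eqP; nra.
have w2_0 : w2 = 0.
  apply/eqP; rewrite -sqrf_eq0; move: S0; rewrite /S w1_0 expr0n mulr0 add0r.
  by move=> /eqP; rewrite mulf_eq0 gt_eqF.
have w3_0 : w3 = 0.
  apply/eqP; have u3_neq0 : u3 != 0.
    by apply: contraTneq u3_gt0 => ->; rewrite expr0n mulr0 ltxx.
  move: uwE; rewrite w1_0 w2_0 !mulr0 addr0 => /esym/eqP.
  by rewrite !mulf_eq0 oppr_eq0 (negPf u3_neq0) lt_eqF.
by rewrite w1_0 w2_0 w3_0 !scale0r !addr0.
Qed.

(* The vector z below is orthogonal to u in the plane, and
   q z z = (q e e * q f f - (q e f)^2) * q u u. *)
Lemma timelike_plane_disc e f x y : lorentzian q ->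
  (forall s t, s *: e + t *: f = 0 -> s = 0 /\ t = 0) ->
  q (x *: e + y *: f) (x *: e + y *: f) < 0 -> q e e * q f f < q e f ^+ 2.
Proof.
move=> Lq free_ef; set u := x *: e + y *: f => u_lt0.
pose s := - (q e f * x + q f f * y); pose t := q e e * x + q e f * y.
have uE : q u u = x * t - y * s.
  by rewrite /u /s /t !sformE (sformC q f e); ring.
have z_neq0 : s *: e + t *: f != 0.
  apply: contraTneq u_lt0 => /free_ef[s0 t0].
  by rewrite uE s0 t0 !mulr0 subrr ltxx.
have uz : q u (s *: e + t *: f) = 0.
  by rewrite /u /s /t !sformE (sformC q f e); ring.
have := timelike_orthogonal_gt0 Lq u_lt0 uz z_neq0.
have -> : q (s *: e + t *: f) (s *: e + t *: f) =
    (q e f ^+ 2 - q e e * q f f) * - q u u.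
  by rewrite /u /s /t !sformE (sformC q f e); ring.
by rewrite pmulr_lgt0 ?oppr_gt0// subr_gt0.
Qed.

Lemma lorentzian_timelike : lorentzian q -> exists u, q u u < 0.
Proof. by move=> [_ [b1 [b2 [b3 [_ _ [_ _ b3_lt0]]]]]]; exists b3. Qed.

Lemma lorentzian_spacelike : lorentzian q -> exists u, 0 < q u u.
Proof. by move=> [_ [b1 [b2 [b3 [_ _ [b1_gt0 _ _]]]]]]; exists b1. Qed.

Lemma nondegenerate_inj u v : nondegenerate q ->
  (forall w, q u w = q v w) -> u = v.
Proof.
move=> /eqP ndq uv; apply/eqP; rewrite -subr_eq0 -memv0 -ndq.
apply/mem_orthovP => w _; apply/eqP.
by rewrite linearBl subr_eq0; apply/eqP; exact: uv.
Qed.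

(** If [e] and [f] were orthogonal, their combination [w] orthogonal to a timelike [u] would satisfy
    q(w, w) = q(u, f)^2 q(e, e) <= 0, yet it is spacelike if nonzero. If w = 0, then [f] itself is
    orthogonal to [u]. *)
Lemma orthogonal_causal_neq0 e f : lorentzian q -> e != 0 -> f != 0 ->
  (forall s t, s *: e + t *: f = 0 -> s = 0 /\ t = 0) ->
  q e e <= 0 -> q f f = 0 -> q e f != 0.
Proof.
move=> Lq e0 f0 free_ef qe qf; apply/eqP => ef0.
have [u u_lt0] := lorentzian_timelike Lq.
pose w := q u f *: e + (- q u e) *: f.
have uw : q u w = 0 by rewrite /w !sformE; ring.
have [w0|w0] := eqVneq w 0.
  have [uf _] := free_ef _ _ w0.
  by have := timelike_orthogonal_gt0 Lq u_lt0 uf f0; rewrite qf ltxx.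
have := timelike_orthogonal_gt0 Lq u_lt0 uw w0.
rewrite /w !sformE (sformC q f e) ef0 qf !mulr0 !addr0 ltNge.
by rewrite mulrA -expr2 mulr_ge0_le0// sqr_ge0.
Qed.

End LorentzianForms.

Section NullVectors.
Variables (R : realType) (V : vectType R) (q : {symmetric V}).

(** The complement of a spacelike [f] is a Lorentzian plane, spanned by the projections [a'] and
    [b']. It has two isotropic lines, and at most one is spanned by [b']; the other contains a
    vector with coefficient 1 on [a]. *)
Lemma null_vector_orthogonal (a b f : V) : lorentzian q ->
  basis_of fullv [:: a; b; f] -> 0 < q f f ->
  exists y z, let v := a + y *: b + z *: f in q v v = 0 /\ q v f = 0.
Proof.
move=> Lq /basis3P[span_abf free_abf] f_gt0.
have f_neq0 : q f f != 0 by rewrite gt_eqF.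
pose a' := a + (- (q a f / q f f)) *: f.
pose b' := b + (- (q b f / q f f)) *: f.
have a'f : q a' f = 0 by rewrite /a' !sformE; field.
have b'f : q b' f = 0 by rewrite /b' !sformE; field.
have free_ab s t : s *: a' + t *: b' = 0 -> s = 0 /\ t = 0.
  move=> st; have [] := free_abf s t (- (s * (q a f / q f f)) - t * (q b f / q f f)).
    rewrite -[RHS]st /a' /b' !scalerDr !scalerA scalerBl scaleNr !mulrN !scaleNr.
    by rewrite addrACA addrA.
  by [].
have [u u_lt0] := lorentzian_timelike Lq.
have [x [y [z uE]]] := span_abf u.
have disc : q a' a' * q b' b' < q a' b' ^+ 2.
  apply: (@timelike_plane_disc _ _ _ a' b' x y) => //.
  (* The projection of a timelike vector stays timelike, as removing the component along a spacelike
     [f] can only lower the square. *)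
  have -> : x *: a' + y *: b' = u + (- (q u f / q f f)) *: f.
    rewrite uE /a' /b' !sformE !scalerDr !scalerA -!addrA; congr (_ + _).
    rewrite [LHS]addrCA; congr (_ + _); rewrite -!scalerDl; congr (_ *: _).
    by field.
  rewrite !sformE (sformC q f u).
  rewrite [X in X < 0](_ : _ = q u u - q u f ^+ 2 / q f f); last by field.
  have : 0 <= q u f ^+ 2 / q f f by rewrite divr_ge0 ?sqr_ge0// ltW.
  lra.
suff [t t0] : exists t, q a' a' + 2 * t * q a' b' + t ^+ 2 * q b' b' = 0.
  exists t, (- (q a f / q f f) - t * (q b f / q f f)).
  have -> : a + t *: b + (- (q a f / q f f) - t * (q b f / q f f)) *: f =
      a' + t *: b'.
    rewrite /a' /b' scalerDr scalerA scalerBl scaleNr mulrN !scaleNr.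
    by rewrite addrACA addrA.
  move: (a') (b') t0 a'f b'f => c d t0 cf df.
  split; last by rewrite !sformE cf df mulr0 addr0.
  by rewrite -[RHS]t0 !sformE (sformC q d c); ring.
have [h22|h22] := eqVneq (q b' b') 0.
  have h12 : q a' b' != 0.
    by apply: contraTneq disc => ->; rewrite h22 mulr0 expr0n ltxx.
  exists (- q a' a' / (2 * q a' b')); rewrite h22; field.
  by rewrite h12.
pose r := Num.sqrt (q a' b' ^+ 2 - q a' a' * q b' b').
have r2 : r ^+ 2 = q a' b' ^+ 2 - q a' a' * q b' b'.
  by rewrite sqr_sqrtr// subr_ge0 ltW.
exists ((r - q a' b') / q b' b').
have -> : q a' a' + 2 * ((r - q a' b') / q b' b') * q a' b' +
    ((r - q a' b') / q b' b') ^+ 2 * q b' b' =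
    (r ^+ 2 - (q a' b' ^+ 2 - q a' a' * q b' b')) / q b' b' by field.
by rewrite r2 subrr mul0r.
Qed.

End NullVectors.

(** * Radial solutions, and the geodesic field in coordinates *)

Lemma quadratic_fieldZ (R : realType) n (c : 'I_n -> 'I_n -> 'I_n -> R) a v :
  quadratic_field c (a *: v) = a ^+ 2 *: quadratic_field c v.
Proof.
apply/rowP => i; rewrite !mxE mulr_sumr; apply: eq_bigr => j _.
by rewrite mulr_sumr; apply: eq_bigr => k _; rewrite !mxE; ring.
Qed.

(* The curve (1 - k t)^-1 v is the solution through v. *)
Lemma idempotent_not_complete (R : realType) n
    (c : 'I_n -> 'I_n -> 'I_n -> R) (v : 'rV[R]_n) (k : R) :
  k != 0 -> v != 0 -> quadratic_field c v = k *: v ->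
  ~ complete_field (quadratic_field c).
Proof.
move=> k_neq0 v_neq0 Fv cF.
have [g g0 dg] := complete_quadratic_field_global v cF.
have cg : integral_curve (quadratic_field c) setT g.
  by split=> // [|]; [exact: openT|exists 0].
pose J := [set t : R | 0 < 1 - k * t].
pose h (t : R) := (1 - k * t)^-1 *: v.
have dlin (t : R) : is_derive t 1 (fun s : R => 1 - k * s) (- k).
  have dk : is_derive t 1 (fun s : R => k * s) k.
    by apply: is_derive_eq; rewrite /GRing.scale /= mulr1.
  rewrite -[- k]sub0r.
  exact: (is_deriveB (is_derive_cst (1 : R) (t : R) (1 : R)) dk).
have ch : integral_curve (quadratic_field c) J h.
  split.
  - have -> : J = (fun t => 1 - k * t) @^-1` [set x | 0 < x] by [].
    apply: open_comp; last exact: open_gt.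
    move=> t _; apply/differentiable_continuous/derivable1_diffP.
    by have := dlin t => d; exact: ex_derive.
  - move=> x y; rewrite /J /= => Jx Jy z xyz.
    have [k0|k0] := leP 0 k; nra.
  - by exists 0; rewrite /J /= mulr0 subr0.
  - move=> t; rewrite /J /= => Jt; apply/is_derive_rVP => i.
    rewrite /h quadratic_fieldZ Fv !mxE.
    rewrite (_ : (fun s => _) = (fun s => v 0 i * (1 - k * s)^-1)); last first.
      by apply/funext => s; rewrite mxE mulrC.
    have d := is_deriveZ (v 0 i) (@is_deriveV _ (fun s => 1 - k * s) _ _ _
      (lt0r_neq0 Jt) (dlin t)).
    apply: is_derive_eq d _; rewrite /GRing.scale /= -exprVn.
    by ring.
have gE t : J t -> (1 - k * t) *: g t = v.
  move=> Jt; have J0 : J 0 by rewrite /J /= mulr0 subr0.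
  rewrite (quadratic_uniqueness cg ch I J0 _ I Jt); last first.
    by rewrite /h mulr0 subr0 invr1 scale1r.
  by rewrite /h scalerA divff ?scale1r// gt_eqF.
pose l := Num.min 0 k^-1; pose u := Num.max 0 k^-1.
have [M M0 gM] : exists2 M, 0 <= M & forall t, l <= t <= u -> `|g t| <= M.
  by apply: derivable_segment_bounded => t _; have := dg t => d; exact: ex_derive.
have v0 : 0 < `|v| by rewrite normr_gt0.
have vM : `|v| <= M by rewrite -g0; apply: gM; rewrite /l /u ge_min le_max lexx.
(* At t = (1 - e) / k the factor 1 - k t equals [e], so |v| = e |g(t)| <= e M, while this choice
   gives e M < |v|. Since |v| <= M also yields e < 1, this time lies between 0 and 1/k. *)
pose e := `|v| / (2 * (M + 1)).
have M1 : 0 < 2 * (M + 1) by lra.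
have e0 : 0 < e by rewrite divr_gt0.
have e1 : e < 1 by rewrite ltr_pdivrMr//; lra.
have ke : 1 - k * ((1 - e) / k) = e by field.
have : `|v| <= e * M.
  rewrite -(gE ((1 - e) / k)); last by rewrite /J /= ke.
  rewrite ke normrZ (gtr0_norm e0) ler_wpM2l ?(ltW e0)//; apply: gM.
  rewrite /l /u ge_min le_max; have [k0|k0] := ltP 0 k.
    have ki : 0 < k^-1 by rewrite invr_gt0.
    by apply/andP; split; apply/orP; [left|right]; nra.
  have ki : k^-1 < 0 by rewrite invr_lt0 lt_neqAle k_neq0.
  by apply/andP; split; apply/orP; [right|left]; nra.
have : e * M < `|v|.
  rewrite /e mulrAC ltr_pdivrMr// ltr_pM2l//; lra.
lra.
Qed.

Lemma is_derive_form (R : realType) n (q : {symmetric 'rV[R]_n})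
    (g h : R -> 'rV[R]_n) dg dh (t : R) :
  is_derive t 1 g dg -> is_derive t 1 h dh ->
  is_derive t 1 (fun s => q (g s) (h s)) (q dg (h t) + q (g t) dh).
Proof.
move=> /is_derive_rVP dgi /is_derive_rVP dhi.
have qE v w : q v w =
    \sum_i \sum_j v 0 i * w 0 j * q (delta_mx 0 i) (delta_mx 0 j).
  rewrite [v in LHS]row_sum_delta [w in LHS]row_sum_delta linear_sumlz.
  apply: eq_bigr => i _; rewrite linear_sumr; apply: eq_bigr => j _.
  by rewrite linearZl_LR linearZr_LR /= mulrA.
rewrite (_ : (fun s => _) = \sum_i \sum_j (fun s =>
    q (delta_mx 0 i) (delta_mx 0 j) * (g s 0 i * h s 0 j))); last first.
  apply/funext => s; rewrite qE fct_sumE; apply: eq_bigr => i _.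
  by rewrite fct_sumE; apply: eq_bigr => j _; rewrite mulrC.
rewrite (_ : q dg _ + _ = \sum_i \sum_j
    (q (delta_mx 0 i) (delta_mx 0 j) * (g t 0 i * dh 0 j + h t 0 j * dg 0 i))).
  apply: is_derive_sum => i; apply: is_derive_sum => j.
  exact: (is_deriveZ (q (delta_mx 0 i) (delta_mx 0 j))
    (is_deriveM (dgi i) (dhi j))).
rewrite !qE -big_split; apply: eq_bigr => i _; rewrite -big_split.
by apply: eq_bigr => j _ /=; ring.
Qed.

Lemma geodesic_field_quadratic (R : realType) n (q : {symmetric 'rV[R]_n})
    (br : {bilinear 'rV[R]_n -> 'rV[R]_n -> 'rV[R]_n}) : lorentzian q ->
  exists c, geodesic_field q br = quadratic_field c.
Proof.
move=> Lq; have [u u_gt0] := lorentzian_spacelike Lq; have [ndq _] := Lq.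
(* [f l] represents the l-th coordinate functional through [q]: transposing a rank one map onto the
   line of [u] and pairing with [u] leaves [w 0 l]. This needs a [u] with q(u, u) nonzero. *)
pose f l := q_transpose q (fun w : 'rV[R]_n => (w 0 l / q u u) *: u) u.
have fE l w : q (f l) w = w 0 l.
  rewrite q_transposeP// ?linearZr_LR /= ?divfK ?gt_eqF// => a x y.
  by rewrite !mxE mulrDl scalerDl -mulrA scalerA.
exists (fun i j k =>
  \sum_l q (delta_mx 0 j) (br (delta_mx 0 k) (delta_mx 0 l)) * f l 0 i).
apply/funext => v; transitivity (\sum_l q v (br v (delta_mx 0 l)) *: f l).
  apply: (nondegenerate_inj ndq) => w; rewrite geodesic_fieldP//.
  rewrite linear_sumlz [w in LHS]row_sum_delta !linear_sumr.
  apply: eq_bigr => l _; rewrite linearZl_LR !linearZr_LR /= mulrC.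
  by congr (_ * _); exact/esym/fE.
apply/rowP => i; rewrite summxE mxE.
have qE l : q v (br v (delta_mx 0 l)) = \sum_j \sum_k
    v 0 j * v 0 k * q (delta_mx 0 j) (br (delta_mx 0 k) (delta_mx 0 l)).
  rewrite [X in q X _]row_sum_delta linear_sumlz; apply: eq_bigr => j _.
  rewrite [X in br X _]row_sum_delta linear_sumlz linear_sumr.
  by apply: eq_bigr => k _; rewrite !linearZl_LR linearZr_LR.
under eq_bigr => l _.
  rewrite mxE qE mulr_suml; under eq_bigr do rewrite mulr_suml.
  over.
rewrite exchange_big; apply: eq_bigr => j _.
rewrite exchange_big; apply: eq_bigr => k _.
by rewrite mulr_suml; apply: eq_bigr => l _; ring.
Qed.

(** * The algebra h(lambda) *)

(** [e2] and [e3] span an abelian ideal, so changing [e1] by an element of it alters no bracket with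
    them. This is the freedom used to make [e1] orthogonal to the plane. *)
Lemma standard_basis_shift (K : fieldType) (V : vectType K) (lambda a b : K)
    (br : {bilinear V -> V -> V}) (e1 e2 e3 : V) :
  lie_bracket br -> standard_basis lambda br e1 e2 e3 ->
  standard_basis lambda br (e1 + a *: e2 + b *: e3) e2 e3.
Proof.
move=> [br_alt _] [/basis3P[span_e free_e] b12 b13 b23].
have combE x y z : x *: (e1 + a *: e2 + b *: e3) + y *: e2 + z *: e3 =
    x *: e1 + (x * a + y) *: e2 + (x * b + z) *: e3.
  rewrite !scalerDr !scalerA !scalerDl !addrA; congr (_ + _); exact: addrAC.
have b32 : br e3 e2 = 0.
  have := br_alt (e2 + e3).
  by rewrite linearDl !linearDr /= !br_alt b23 !add0r addr0.
split.
- apply/basis3P; split=> [v|x y z].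
    have [x [y [z ->]]] := span_e v.
    exists x, (y - x * a), (z - x * b).
    by rewrite combE !(addrC (x * _)) !subrK.
  rewrite combE => /free_e[-> + +]; rewrite !mul0r !add0r => -> ->.
  by split.
- by rewrite !linearDl !linearZl_LR /= br_alt b12 b32 !scaler0 !addr0.
- by rewrite !linearDl !linearZl_LR /= br_alt b13 b23 !scaler0 !addr0.
- by [].
Qed.

Section StandardBasis.
Variables (R : realType) (V : vectType R) (lambda : R).
Variables (br : {bilinear V -> V -> V}) (q : {symmetric V}) (e1 e2 e3 : V).
Hypotheses (br_lie : lie_bracket br) (std : standard_basis lambda br e1 e2 e3).
Hypothesis Lq : lorentzian q.

Let span_e v : exists x y z, v = x *: e1 + y *: e2 + z *: e3.
Proof. by have [/basis3P[span_e _] _ _ _] := std; exact: span_e. Qed.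

Let free_e x y z : x *: e1 + y *: e2 + z *: e3 = 0 -> [/\ x = 0, y = 0 & z = 0].
Proof. by have [/basis3P[_ free_e] _ _ _] := std; exact: free_e. Qed.

Lemma standard_basis_plane_free x y : x *: e2 + y *: e3 = 0 -> x = 0 /\ y = 0.
Proof.
move=> xy; have [] := @free_e 0 x y; last by [].
by rewrite scale0r add0r.
Qed.

Lemma standard_basis_neq0 : e2 != 0 /\ e3 != 0.
Proof.
split; apply/eqP => e0.
  have [] := @standard_basis_plane_free 1 0.
    by rewrite e0 scaler0 scale0r addr0.
  by move=> /eqP; rewrite oner_eq0.
have [] := @standard_basis_plane_free 0 1.
  by rewrite e0 scaler0 scale0r addr0.
by move=> _ /eqP; rewrite oner_eq0.
Qed.

Lemma standard_bracketE x y z : let v := x *: e1 + y *: e2 + z *: e3 in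
  [/\ br v e1 = (- y) *: e2 + (- (lambda * z)) *: e3, br v e2 = x *: e2 &
      br v e3 = (lambda * x) *: e3].
Proof.
have [_ b12 b13 b23] := std; have [br_alt _] := br_lie.
have anti u v : br u v = - br v u.
  apply/eqP; rewrite -addr_eq0; apply/eqP.
  have := br_alt (u + v).
  by rewrite linearDl !linearDr /= !br_alt add0r addr0.
move=> v; rewrite /v !linearDl !linearZl_LR /= !br_alt b12 b13 b23.
rewrite (anti e2 e1) (anti e3 e1) (anti e3 e2) b12 b13 b23.
rewrite !scaler0 oppr0 scaler0 !addr0 add0r !scalerN !scaleNr !scalerA.
by rewrite (mulrC z) (mulrC x).
Qed.

Lemma geodesic_field_eqP v w : q w e1 = q v (br v e1) ->
  q w e2 = q v (br v e2) -> q w e3 = q v (br v e3) -> geodesic_field q br v = w.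
Proof.
move=> w1 w2 w3; have [ndq _] := Lq; apply: (nondegenerate_inj ndq) => u.
rewrite geodesic_fieldP//; have [x [y [z ->]]] := span_e u.
by rewrite !linearDr !linearZr_LR /= w1 w2 w3.
Qed.

(** With p3 = 0, isotropy reads p1 = - y p2, which is the [e1] component of the claim; here x1 = 1
    gives p2' = p2. *)
Lemma geodesic_field_idempotent3 y z : let v := e1 + y *: e2 + z *: e3 in
  q v v = 0 -> q v e3 = 0 -> geodesic_field q br v = v.
Proof.
move=> v vv v3; have [] := standard_bracketE 1 y z.
rewrite scale1r -/v => b1 b2 b3.
have : q v v = q v e1 + y * q v e2 + z * q v e3.
  by rewrite {2}/v !sformDr !sformZr.
rewrite vv v3 mulr0 addr0 => vvE.
apply: geodesic_field_eqP.
- by rewrite b1 sformDr !sformZr v3; lra.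
- by rewrite b2 scale1r.
- by rewrite b3 sformZr v3 mulr0.
Qed.

(** With p2 = 0, isotropy reads p1 = - z p3, and [e3] has weight lambda under [e1]; the factor is
    nonzero only for nonzero lambda. *)
Lemma geodesic_field_idempotent2 y z : let v := e1 + y *: e2 + z *: e3 in
  q v v = 0 -> q v e2 = 0 -> geodesic_field q br v = lambda *: v.
Proof.
move=> v vv v2; have [] := standard_bracketE 1 y z.
rewrite scale1r -/v => b1 b2 b3.
have : q v v = q v e1 + y * q v e2 + z * q v e3.
  by rewrite {2}/v !sformDr !sformZr.
rewrite vv v2 mulr0 addr0 => vvE.
apply: geodesic_field_eqP; rewrite sformZl.
- rewrite b1 sformDr !sformZr v2 mulr0 add0r.
  have -> : q v e1 = - (z * q v e3) by lra.
  ring.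
- by rewrite b2 sformZr v2 !mulr0.
- by rewrite b3 sformZr mulr1.
Qed.

(** A timelike vector in the plane of [e2] and [e3] makes its Gram determinant negative, so Cramer's
    rule gives the correction of [e1]; the result is orthogonal to that timelike vector, hence
    spacelike. This form serves both timelike and lightlike [e3]. *)
Lemma orthogonal_standard_basis s t :
  q (s *: e2 + t *: e3) (s *: e2 + t *: e3) < 0 ->
  q e2 e2 * q e3 e3 < q e2 e3 ^+ 2 /\
  exists f, [/\ standard_basis lambda br f e2 e3, q f e2 = 0, q f e3 = 0 &
                0 < q f f].
Proof.
move=> u_lt0.
have disc := timelike_plane_disc Lq standard_basis_plane_free u_lt0; split=> //.
pose D := q e2 e2 * q e3 e3 - q e2 e3 ^+ 2.
have D0 : D != 0 by rewrite lt_eqF// subr_lt0.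
pose a := (q e1 e3 * q e2 e3 - q e1 e2 * q e3 e3) / D.
pose b := (q e1 e2 * q e2 e3 - q e1 e3 * q e2 e2) / D.
pose f := e1 + a *: e2 + b *: e3.
have f2 : q f e2 = 0.
  by rewrite /f !sformE (sformC q e3 e2) /a /b /D; field.
have f3 : q f e3 = 0.
  by rewrite /f !sformE /a /b /D; field.
exists f; split=> //; first exact: standard_basis_shift.
apply: (timelike_orthogonal_gt0 Lq u_lt0).
  by rewrite sformC sformDr !sformZr f2 f3 !mulr0 addr0.
apply/eqP => f0; have [] := @free_e 1 a b; first by rewrite scale1r.
by move=> /eqP; rewrite oner_eq0.
Qed.

Lemma lightlike_plane_timelike : q e3 e3 = 0 -> q e2 e3 != 0 ->
  exists s t, q (s *: e2 + t *: e3) (s *: e2 + t *: e3) < 0.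
Proof.
(* With s = 1 the square is q(e2, e2) + 2 t q(e2, e3), and t is chosen to make it -1. *)
move=> e33 e23; exists 1, (- (1 + q e2 e2) / (2 * q e2 e3)).
rewrite !sformE (sformC q e3 e2) e33 [X in X < 0](_ : _ = -1) ?ltrN10//.
by field.
Qed.

Section Orthogonal.
Hypotheses (e12 : q e1 e2 = 0) (e13 : q e1 e3 = 0).

Let e21 : q e2 e1 = 0. Proof. by rewrite sformC. Qed.
Let e31 : q e3 e1 = 0. Proof. by rewrite sformC. Qed.
Let e32 : q e3 e2 = q e2 e3. Proof. by rewrite sformC. Qed.

(** Inverting the Gram matrix recovers v from its momenta. The scalar system arises with a = q(e1,
    e1), A = q(e3, e3) / D, B = - 2 q(e2, e3) / D and C = q(e2, e2) / D, which make its energy q(v,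
    v). *)
Lemma momentum_system v (D := q e2 e2 * q e3 e3 - q e2 e3 ^+ 2) :
  q e1 e1 != 0 -> D != 0 ->
  [/\ q v (br v e1) = - (q e3 e3 / D * q v e2 ^+ 2
        + (1 + lambda) / 2 * (- 2 * q e2 e3 / D) * (q v e2 * q v e3)
        + lambda * (q e2 e2 / D) * q v e3 ^+ 2),
      q v (br v e2) = q v e1 / q e1 e1 * q v e2,
      q v (br v e3) = lambda * (q v e1 / q e1 e1) * q v e3 &
      v = (q v e1 / q e1 e1) *: e1
        + ((q e3 e3 * q v e2 - q e2 e3 * q v e3) / D) *: e2
        + ((q e2 e2 * q v e3 - q e2 e3 * q v e2) / D) *: e3].
Proof.
move=> a0 D0; have [x [y [z ->]]] := span_e v.
have [-> -> ->] := standard_bracketE x y z.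
rewrite !sformE e12 e13 e21 e31 e32 /D in D0 *.
split; [by field; rewrite ?D0 ?a0|by field|by field|].
by congr (_ *: _ + _ *: _ + _ *: _); field; rewrite ?D0 ?a0.
Qed.

(** An initial vector for the Riccati argument: the coefficient 1 on [e2] makes isotropy a linear
    equation in z, and the coefficient 1 on [e1] makes the first momentum positive once [e1] is
    spacelike. *)
Lemma lightlike_plane_isotropic : q e3 e3 = 0 -> q e2 e3 != 0 ->
  exists z, q (e1 + e2 + z *: e3) (e1 + e2 + z *: e3) = 0 /\
    q (e1 + e2 + z *: e3) e1 = q e1 e1.
Proof.
move=> e33 e23; exists (- (q e1 e1 + q e2 e2) / (2 * q e2 e3)).
by rewrite !sformE e12 e13 e21 e31 e32 e33; split; [field|rewrite mulr0 !addr0].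
Qed.

(* On the isotropic cone, with v = x e1 + y e2 + z e3, the right-hand side is
   (1 + lambda) / 2 * q e1 e1 * x ^ 2 - (1 - lambda) / 2 * q e2 e2 * y ^ 2. *)
Lemma isotropic_riccati v : q e1 e1 != 0 -> q e2 e2 <= 0 -> q e3 e3 = 0 ->
  lambda < 1 -> q v v = 0 ->
  (1 + lambda) / (2 * q e1 e1) * q v e1 ^+ 2 <= q v (br v e1).
Proof.
move=> a0 e22 e33 l1; have [x [y [z ->]]] := span_e v.
have [-> _ _] := standard_bracketE x y z.
rewrite !sformE e12 e13 e21 e31 e32 e33 => vv.
rewrite -subr_ge0 [leRHS](_ : _ = - ((1 - lambda) / 2 * q e2 e2 * y ^+ 2)).
  by rewrite -mulNr mulr_ge0 ?sqr_ge0// -mulrN mulr_ge0 ?oppr_ge0// divr_ge0//; lra.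
have -> : (1 + lambda) / (2 * q e1 e1) * (x * q e1 e1 + y * 0 + z * 0) ^+ 2 =
    (1 + lambda) / 2 * (x * (x * q e1 e1)) by field.
have -> : x * (x * q e1 e1) = - (y * (y * q e2 e2) + 2 * y * z * q e2 e3) by lra.
by field.
Qed.

(** The affine line through [e1] in direction [e2] is invariant, and the field on it is y' = lambda
    y. *)
Lemma geodesic_field_unbounded_direction y : q e2 e2 = 0 ->
  geodesic_field q br (e1 + y *: e2) = (lambda * y) *: e2.
Proof.
move=> e22; have [] := standard_bracketE 1 y 0.
rewrite scale1r scale0r addr0 => b1 b2 b3; apply: geodesic_field_eqP.
- rewrite b1 !sformE e12 e13 e21 e22; ring.
- by rewrite b2 !sformE e12 e22; ring.
- by rewrite b3 !sformE e13; ring.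
Qed.

End Orthogonal.
End StandardBasis.

(** * Completeness *)

Lemma bounded_curveP (R : realType) (V : normedModType R) (I : set R)
    (g : R -> V) :
  bounded_curve I g <-> exists M, forall t, I t -> `|g t| <= M.
Proof.
split=> [/pinfty_ex_gt0[M _ gM]|[M gM]].
  by exists M => t It; apply: (gM (g t)); exists t.
exists M; split; first exact: num_real.
by move=> x Mx _ [t It <-]; exact: le_trans (gM t It) (ltW Mx).
Qed.

Section Completeness.
Variables (R : realType) (lambda : R).
Variable br : {bilinear 'rV[R]_3 -> 'rV[R]_3 -> 'rV[R]_3}.
Variables (e1 e2 e3 : 'rV[R]_3) (q : {symmetric 'rV[R]_3}).
Hypotheses (lambda_neq0 : lambda != 0) (lambda_lt1 : `|lambda| < 1).
Hypotheses (br_lie : lie_bracket br) (std : standard_basis lambda br e1 e2 e3).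
Hypothesis Lq : lorentzian q.

Let F := geodesic_field q br.

Let e1_shift_neq0 y z : e1 + y *: e2 + z *: e3 != 0.
Proof.
apply/eqP => v0; have [/basis3P[_ /(_ 1 y z)] + _ _ _] := std.
by rewrite scale1r => /(_ v0)[/eqP]; rewrite oner_eq0.
Qed.

Lemma spacelike3_not_complete : 0 < q e3 e3 -> ~ geodesically_complete q br.
Proof.
move=> e33; have [basis _ _ _] := std.
have [y [z [vv v3]]] := null_vector_orthogonal Lq basis e33.
have [c cE] := geodesic_field_quadratic br Lq.
rewrite /geodesically_complete cE.
apply: (@idempotent_not_complete _ _ c (e1 + y *: e2 + z *: e3) 1) => //.
by rewrite -cE scale1r; exact: (geodesic_field_idempotent3 br_lie std Lq).
Qed.

Lemma spacelike2_not_complete : 0 < q e2 e2 -> ~ geodesically_complete q br.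
Proof.
move=> e22; have [basis _ _ _] := std.
have basis' : basis_of fullv [:: e1; e3; e2].
  rewrite (@perm_basis _ _ _ [:: e1; e2; e3])// perm_cons.
  by rewrite -[[:: e3; e2]]/([:: e3] ++ [:: e2]) perm_catC.
have [y [z [vv v2]]] := null_vector_orthogonal Lq basis' e22.
have [c cE] := geodesic_field_quadratic br Lq.
rewrite addrAC in vv v2.
rewrite /geodesically_complete cE.
apply: (@idempotent_not_complete _ _ c (e1 + z *: e2 + y *: e3) lambda) => //.
by rewrite -cE; exact: (geodesic_field_idempotent2 br_lie std Lq).
Qed.

Lemma is_derive_momentum g (t : R) w : is_derive t 1 g (F (g t)) ->
  is_derive t 1 (fun s => q (g s) w) (q (g t) (br (g t) w)).
Proof.
move=> dg; have [ndq _] := Lq.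
have := is_derive_form q dg (is_derive_cst w t (1 : R)).
by rewrite geodesic_fieldP// linear0r addr0.
Qed.

Lemma isotropic_invariant g : (forall t : R, is_derive t 1 g (F (g t))) ->
  q (g 0) (g 0) = 0 -> forall t, q (g t) (g t) = 0.
Proof.
move=> dg q0 t; rewrite -q0; have [ndq _] := Lq.
apply: (@is_derive_0_is_cst R (fun s => q (g s) (g s))) => x.
have := is_derive_form q (dg x) (dg x).
have gF : q (g x) (F (g x)) = q (F (g x)) (g x) by exact: sformC.
have Fg : q (F (g x)) (g x) = 0.
  have [br_alt _] := br_lie.
  by rewrite [LHS](geodesic_fieldP _ _ _ ndq) br_alt linear0r.
by rewrite gF Fg addr0.
Qed.

Lemma lightlike3_not_complete : q e3 e3 = 0 -> q e2 e2 <= 0 ->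
  ~ geodesically_complete q br.
Proof.
move=> e33 e22 cq.
have [e2_neq0 e3_neq0] := standard_basis_neq0 std.
have e23 : q e2 e3 != 0.
  exact: (orthogonal_causal_neq0 Lq e2_neq0 e3_neq0
    (standard_basis_plane_free std) e22 e33).
have [s [u u_lt0]] := lightlike_plane_timelike e33 e23.
have [_ [f [std_f f2 f3 f_gt0]]] := orthogonal_standard_basis br_lie std Lq u_lt0.
have f_neq0 : q f f != 0 by rewrite gt_eqF.
have [z [vv vf]] := lightlike_plane_isotropic f2 f3 e33 e23.
set v := f + e2 + z *: e3 in vv vf.
have [c cE] := geodesic_field_quadratic br Lq.
have [g g0 dg] : exists2 g, g 0 = v & forall t : R, is_derive t 1 g (F (g t)).
  rewrite /F cE; apply: complete_quadratic_field_global.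
  by rewrite -cE.
have l1 : lambda < 1 by move: lambda_lt1; rewrite ltr_norml => /andP[].
have lN1 : -1 < lambda by move: lambda_lt1; rewrite ltr_norml => /andP[].
have gg : forall t, q (g t) (g t) = 0.
  by apply: (isotropic_invariant dg); rewrite g0.
apply: (@riccati_blowup R (fun t => q (g t) f) (fun t => q (g t) (br (g t) f))
  ((1 + lambda) / (2 * q f f))).
- by rewrite divr_gt0 ?mulr_gt0//; lra.
- by rewrite g0 vf.
- by move=> t; exact: is_derive_momentum.
- move=> t.
  exact: (isotropic_riccati br_lie std_f f2 f3 f_neq0 e22 e33 l1 (gg t)).
Qed.

Section Orthogonal.
Hypotheses (e12 : q e1 e2 = 0) (e13 : q e1 e3 = 0) (e11 : 0 < q e1 e1).
Hypotheses (e22 : q e2 e2 <= 0) (e33 : q e3 e3 < 0).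
Hypothesis disc : q e2 e2 * q e3 e3 < q e2 e3 ^+ 2.

Let D := q e2 e2 * q e3 e3 - q e2 e3 ^+ 2.
Let D_lt0 : D < 0. Proof. by rewrite subr_lt0. Qed.

Let momentumE v :
  [/\ q v (br v e1) = - (q e3 e3 / D * q v e2 ^+ 2
        + (1 + lambda) / 2 * (- 2 * q e2 e3 / D) * (q v e2 * q v e3)
        + lambda * (q e2 e2 / D) * q v e3 ^+ 2),
      q v (br v e2) = q v e1 / q e1 e1 * q v e2,
      q v (br v e3) = lambda * (q v e1 / q e1 e1) * q v e3 &
      v = (q v e1 / q e1 e1) *: e1
        + ((q e3 e3 * q v e2 - q e2 e3 * q v e3) / D) *: e2
        + ((q e2 e2 * q v e3 - q e2 e3 * q v e2) / D) *: e3].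
Proof.
apply: (momentum_system br_lie std e12 e13); first exact: lt0r_neq0.
exact: ltr0_neq0.
Qed.

Lemma momentum_norm_bound : exists2 L, 0 <= L & forall v P, 0 <= P ->
  `|q v e1| <= P -> `|q v e2| <= P -> `|q v e3| <= P -> `|v| <= L * P.
Proof.
exists (`|e1| / q e1 e1 + (`|q e3 e3| + `|q e2 e3|) / - D * `|e2|
    + (`|q e2 e2| + `|q e2 e3|) / - D * `|e3|).
  by rewrite !addr_ge0 ?mulr_ge0 ?invr_ge0 ?addr_ge0 ?oppr_ge0// ltW.
move=> v P P0 v1 v2 v3; have [_ _ _ vE] := momentumE v.
have coef a b x y : `|x| <= P -> `|y| <= P ->
    `|(a * x - b * y) / D| <= (`|a| + `|b|) / - D * P.
  move=> xP yP; rewrite normrM normfV (ltr0_norm D_lt0) [leRHS]mulrAC.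
  rewrite ler_wpM2r ?invr_ge0 ?oppr_ge0 ?(ltW D_lt0)//.
  rewrite (le_trans (ler_normB _ _))// mulrDl !normrM.
  by rewrite lerD// ler_wpM2l.
rewrite vE [leRHS]mulrDl [X in _ <= X + _]mulrDl.
apply: le_trans (ler_normD _ _) _; apply: lerD.
  apply: le_trans (ler_normD _ _) _; apply: lerD; rewrite normrZ.
    rewrite normrM normfV (gtr0_norm e11) mulrC -!mulrA ler_wpM2l//.
    by rewrite mulrC ler_wpM2l// invr_ge0 ltW.
  by rewrite [leRHS]mulrAC ler_wpM2r// coef.
by rewrite normrZ [leRHS]mulrAC ler_wpM2r// coef.
Qed.

Let abs_le_sqr (x M : R) : x ^+ 2 <= M -> `|x| <= 1 + M.
Proof.
rewrite -real_normK ?num_real// => xM.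
by have := sqr_ge0 (`|x| - 1); have := normr_ge0 x; nra.
Qed.

Let momentum_derive I g : integral_curve F I g ->
  [/\ forall t, I t -> is_derive t 1 (fun s => q (g s) e1)
       (- (q e3 e3 / D * q (g t) e2 ^+ 2
        + (1 + lambda) / 2 * (- 2 * q e2 e3 / D) * (q (g t) e2 * q (g t) e3)
        + lambda * (q e2 e2 / D) * q (g t) e3 ^+ 2)),
      forall t, I t -> is_derive t 1 (fun s => q (g s) e2)
        (q (g t) e1 / q e1 e1 * q (g t) e2) &
      forall t, I t -> is_derive t 1 (fun s => q (g s) e3)
        (lambda * (q (g t) e1 / q e1 e1) * q (g t) e3)].
Proof.
move=> [_ _ _ dg]; split=> t It; have [E1 E2 E3 _] := momentumE (g t).
- by rewrite -E1; exact/is_derive_momentum/dg.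
- by rewrite -E2; exact/is_derive_momentum/dg.
- by rewrite -E3; exact/is_derive_momentum/dg.
Qed.

Let A_gt0 : 0 < q e3 e3 / D.
Proof. by rewrite nmulr_rgt0// invr_lt0. Qed.

Let C_ge0 : 0 <= q e2 e2 / D.
Proof. by rewrite mulr_le0// invr_le0 ltW. Qed.

Let momentum_bound I g : integral_curve F I g -> exists2 M, 0 <= M &
  forall t, I t -> [/\ q (g t) e1 ^+ 2 <= M, q (g t) e2 ^+ 2 <= M &
    q e2 e2 / D * q (g t) e3 ^+ 2 <= M].
Proof.
move=> cg; have [_ itvI _ _] := cg; have [d1 d2 d3] := momentum_derive cg.
have [M EM] := momentum_energy_bound e11 A_gt0 C_ge0 lambda_lt1 itvI d1 d2 d3.
have A := A_gt0; have C := C_ge0; have a := e11.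
have [N n3 MN] : exists2 N, 0 <= N & M <= N by exists `|M|; rewrite ?ler_norm.
have n1 : 0 <= q e1 e1 * N by rewrite mulr_ge0// ltW.
have n2 : 0 <= N / (q e3 e3 / D) by rewrite divr_ge0// ltW.
exists (q e1 e1 * N + N / (q e3 e3 / D) + N) => [|t It]; first by lra.
have := EM t It; set p1 := q (g t) e1; set p2 := q (g t) e2; set p3 := q (g t) e3.
have h1 : 0 <= p1 ^+ 2 / q e1 e1 by rewrite divr_ge0 ?sqr_ge0// ltW.
have h2 : 0 <= q e3 e3 / D * p2 ^+ 2 by rewrite mulr_ge0 ?sqr_ge0// ltW.
have h3 : 0 <= q e2 e2 / D * p3 ^+ 2 by rewrite mulr_ge0 ?sqr_ge0.
move=> EMt.
have b1 : p1 ^+ 2 <= q e1 e1 * N by rewrite mulrC -ler_pdivrMr//; lra.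
have b2 : p2 ^+ 2 <= N / (q e3 e3 / D) by rewrite ler_pdivlMr// mulrC; lra.
by split; lra.
Qed.

Lemma orthogonal_complete : geodesically_complete q br.
Proof.
move=> I g maxg; have [cg _] := maxg; have [_ itvI _ _] := cg.
have [c cE] := geodesic_field_quadratic br Lq; rewrite cE in maxg.
apply: (maximal_integral_curve_complete maxg) => T.
have [d1 d2 d3] := momentum_derive cg.
have [N p3N] := momentum_growth_bound e11 A_gt0 C_ge0 lambda_lt1 itvI d1 d2 d3 T.
have [M M0 pM] := momentum_bound cg; have [L L0 norm_le] := momentum_norm_bound.
exists (L * (1 + M + `|N|)) => t It tT; have [p1M p2M _] := pM t It.
have N0 := normr_ge0 N; have NN := ler_norm N.
apply: norm_le; first by lra.
- by have := abs_le_sqr p1M; lra.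
- by have := abs_le_sqr p2M; lra.
- by have := abs_le_sqr (p3N t It tT); lra.
Qed.

(** For timelike [e2] the coefficient C is positive, so the energy bound controls the third momentum
    at all times. *)
Lemma orthogonal_bounded I g : q e2 e2 < 0 -> integral_curve F I g ->
  bounded_curve I g.
Proof.
move=> e22_lt0 cg; apply/bounded_curveP.
have [M M0 pM] := momentum_bound cg; have [L L0 norm_le] := momentum_norm_bound.
have C0 : 0 < q e2 e2 / D by rewrite nmulr_rgt0// invr_lt0.
have N0 : 0 <= M / (q e2 e2 / D) by rewrite divr_ge0// ltW.
exists (L * (1 + M + M / (q e2 e2 / D))) => t It; have [p1M p2M p3M] := pM t It.
have p3N : q (g t) e3 ^+ 2 <= M / (q e2 e2 / D) by rewrite ler_pdivlMr// mulrC.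
apply: norm_le; first by lra.
- by have := abs_le_sqr p1M; lra.
- by have := abs_le_sqr p2M; lra.
- by have := abs_le_sqr p3N; lra.
Qed.

Lemma orthogonal_unbounded : q e2 e2 = 0 -> exists (I : set R) g,
  maximal_integral_curve F I g /\ ~ bounded_curve I g.
Proof.
move=> e22_0; pose g (t : R) := e1 + expR (lambda * t) *: e2.
exists setT, g; split.
  split=> [|J h _ TJ _]; last by apply/seteqP; split.
  split=> // [|//|t _]; [exact: openT|by exists 0|].
  have -> : F (g t) = (lambda * expR (lambda * t)) *: e2.
    exact: (geodesic_field_unbounded_direction br_lie std Lq e12 e13).
  apply/is_derive_rVP => i; rewrite mxE.
  rewrite (_ : (fun s => _) =
      (fun s => e1 0 i + e2 0 i * expR (lambda * s))); last first.
    by apply/funext => s; rewrite !mxE mulrC.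
  have d := is_deriveD (is_derive_cst (e1 0 i : R) (t : R) (1 : R))
    (is_deriveZ (e2 0 i) (is_derive_expRM lambda t)).
  by apply: is_derive_eq d _; rewrite add0r /GRing.scale /= mulrC.
move=> /bounded_curveP[M gM].
have [e2_neq0 _] := standard_basis_neq0 std.
have e2_gt0 : 0 < `|e2| by rewrite normr_gt0.
(* At time s / lambda, for either sign of lambda, a bound [M] would force exp(s) <= s, against 1 + s
   <= exp(s). *)
pose s := (M + `|e1|) / `|e2|.
have := gM (s / lambda) I; rewrite /g (mulrC lambda) divfK// => gs.
have : expR s * `|e2| <= M + `|e1|.
  rewrite -(gtr0_norm (expR_gt0 s)) -normrZ.
  rewrite -[_ *: e2](addKr e1) addrC (le_trans (ler_normB _ _))// lerD2r.
  exact: gs.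
rewrite -ler_pdivlMr// -/s; apply/negP; rewrite -ltNge.
by apply: lt_le_trans (expR_ge1Dx s); rewrite ltrDr.
Qed.

End Orthogonal.
End Completeness.

Theorem theorem1p2 (R : realType) (lambda : R)
  (br : {bilinear 'rV[R]_3 -> 'rV[R]_3 -> 'rV[R]_3})
  (e1 e2 e3 : 'rV[R]_3) (q : {symmetric 'rV[R]_3}) :
  0 < `|lambda| < 1 ->
  lie_bracket br ->
  standard_basis lambda br e1 e2 e3 ->
  lorentzian q ->
  [/\ geodesically_complete q br <-> (timelike q e3 /\ ~ spacelike q e2),
      timelike q e3 -> timelike q e2 ->
        forall (I : set R) (g : R -> 'rV[R]_3),
          maximal_integral_curve (geodesic_field q br) I g -> bounded_curve I g
    & timelike q e3 -> lightlike q e2 ->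
        exists (I : set R) (g : R -> 'rV[R]_3),
          maximal_integral_curve (geodesic_field q br) I g /\
          ~ bounded_curve I g].
Proof.
move=> /andP[lambda_neq0 lambda_lt1] br_lie std Lq.
rewrite normr_gt0 in lambda_neq0.
have [e2_neq0 e3_neq0] := standard_basis_neq0 std.
have adapted : q e3 e3 < 0 -> q e2 e2 * q e3 e3 < q e2 e3 ^+ 2 /\
    exists f, [/\ standard_basis lambda br f e2 e3, q f e2 = 0, q f e3 = 0 &
                0 < q f f].
  move=> e33; apply: (@orthogonal_standard_basis _ _ _ _ _ _ _ _ br_lie std Lq 0 1).
  by rewrite scale0r add0r scale1r.
split.
- split=> [cq|[[_ e33] nspace2]].
    (* This comes first because the lightlike case of [e3] relies on it. *)
    have e22 : q e2 e2 <= 0.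
      rewrite leNgt; apply/negP => e22.
      exact: (spacelike2_not_complete lambda_neq0 br_lie std Lq e22).
    split; last by move=> [_]; rewrite ltNge e22.
    split=> //; case: (ltgtP (q e3 e3) 0) => // e33.
      by case: (spacelike3_not_complete br_lie std Lq e33).
    by case: (lightlike3_not_complete lambda_lt1 br_lie std Lq e33 e22).
  have e22 : q e2 e2 <= 0.
    by rewrite leNgt; apply/negP => e22; apply: nspace2.
  have [disc [f [std_f f2 f3 f0]]] := adapted e33.
  exact: (orthogonal_complete lambda_lt1 br_lie std_f Lq f2 f3 f0 e22 e33 disc).
- move=> [_ e33] [_ e22] I g [cg _].
  have [disc [f [std_f f2 f3 f0]]] := adapted e33.
  exact: (orthogonal_bounded lambda_lt1 br_lie std_f Lq f2 f3 f0 (ltW e22) e33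
    disc e22 cg).
- move=> [_ e33] [_ e22].
  have [disc [f [std_f f2 f3 f0]]] := adapted e33.
  exact: (orthogonal_unbounded lambda_neq0 br_lie std_f Lq f2 f3 e22).
Qed.
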